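(* Let $\mu\in\mathbb{C}$ with $\mu\neq-1,-2,-3,\ldots$ and let $\ell\in\mathbb{N}_0$. Then for every $j\in\mathbb{N}_0$: (1) $M_j^{\mu,\ell}(x)$ is a polynomial in $x$ of degree $j+\ell$; (2) (top term) $M_j^{\mu,\ell}(x)=\frac{(-1)^j}{j!}x^{j+\ell}+(\text{terms of degree}<j+\ell)$; (3) (constant term) $$M_j^{\mu,\ell}(0)=\frac{2^{2\ell-\mu}\Gamma(\ell+\frac12)\Gamma(j+\mu+1)\left(\frac{\mu+1}{2}-\ell\right)_j}{j!\,\Gamma(\frac{\mu+2}{2})\,\Gamma(j+\frac{\mu+1}{2})},$$ where $(a)_n=a(a+1)\cdots(a+n-1)$ is the Pochhammer symbol.
   Context: Let $I_\alpha$, $K_\alpha$ be the modified Bessel functions and set $\widetilde I_\alpha(z)=(z/2)^{-\alpha}I_\alpha(z)$, $\widetilde K_\alpha(z)=(z/2)^{-\alpha}K_\alpha(z)$. For $\mu\in\mathbb{C}$, $\ell\in\mathbb{N}_0$, $x>0$ and $t$ near $0$ define $$G^{\mu,\ell}(t,x)=\frac{1}{(1-t)^{\ell+\frac{\mu+3}{2}}}\left(\frac x2\right)^{2\ell+1}e^{\frac x2}\,\widetilde I_{\frac\mu2}\!\left(\frac{tx}{2(1-t)}\right)\widetilde K_{\ell+\frac12}\!\left(\frac{x}{2(1-t)}\right),$$ and for $j\in\mathbb{N}_0$ $$M_j^{\mu,\ell}(x)=\frac{\Gamma(j+\mu+1)}{j!\,2^\mu\,\Gamma(j+\frac{\mu+1}{2})}\left.\frac{\partial^j}{\partial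 t^j}\right|_{t=0}G^{\mu,\ell}(t,x).$$ *)

(* Defs.v *)
From Stdlib Require Import Reals.
From Coquelicot Require Import Coquelicot.

Open Scope R_scope.

Definition cexp (z : C) : C :=
  (exp (Re z) * cos (Im z), exp (Re z) * sin (Im z)).
Definition rcpow (a : R) (z : C) : C := cexp (Cmult z (RtoC (ln a))).

Definition Clim_seq (u : nat -> C) : C :=
  (real (Lim_seq (fun n => Re (u n))), real (Lim_seq (fun n => Im (u n)))).
Definition CSeries (a : nat -> C) : C :=
  (Series (fun n => Re (a n)), Series (fun n => Im (a n))).

Fixpoint poch (a : C) (n : nat) : C :=
  match n with
  | O => RtoC 1
  | S m => Cmult (poch a m) (Cplus a (RtoC (INR m)))
  end.

(** Reciprocal Gamma function (entire), via Gauss' product formula: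
    1/Gamma(z) = lim_n z(z+1)...(z+n) / (n! n^z). *)
Definition rgamma (z : C) : C :=
  Clim_seq (fun n => Cdiv (poch z (S n))
                          (Cmult (RtoC (INR (Factorial.fact n))) (rcpow (INR n) z))).
(** Gamma function (meaningful away from 0,-1,-2,...). *)
Definition CGamma (z : C) : C := Cinv (rgamma z).

(** Itilde_nu(w) = (w/2)^{-nu} I_nu(w) = sum_k (w/2)^{2k} / (k! Gamma(k+nu+1)). *)
Definition Itilde (nu : C) (w : C) : C :=
  CSeries (fun k => Cmult (Cdiv (Cpow (Cdiv w (RtoC 2)) (2 * k))
                                 (RtoC (INR (Factorial.fact k))))
                          (rgamma (Cplus (Cplus (RtoC (INR k)) nu) (RtoC 1)))).

(** Modified Bessel functions for z > 0:
    I_nu(z) = (z/2)^nu Itilde_nu(z),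
    K_nu(z) = pi/2 (I_{-nu}(z) - I_nu(z)) / sin(nu pi)   (nu not an integer). *)
Definition BesselI (nu : C) (z : R) : C :=
  Cmult (rcpow (z / 2) nu) (Itilde nu (RtoC z)).
Definition BesselK (nu : R) (z : R) : C :=
  Cdiv (Cmult (RtoC (PI / 2)) (Cminus (BesselI (RtoC (- nu)) z) (BesselI (RtoC nu) z)))
       (RtoC (sin (nu * PI))).
Definition Ktilde (nu : R) (z : R) : C :=
  Cmult (RtoC (Rpower (z / 2) (- nu))) (BesselK nu z).

Definition Cderive_n (f : R -> C) (j : nat) (t : R) : C :=
  (Derive_n (fun s => Re (f s)) j t, Derive_n (fun s => Im (f s)) j t).

Definition G (mu : C) (l : nat) (t x : R) : C :=
  Cmult (Cmult (Cmult
    (rcpow (1 - t) (Copp (Cplus (RtoC (INR l)) (Cdiv (Cplus mu (RtoC 3)) (RtoC 2)))))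
    (RtoC ((x / 2) ^ (2 * l + 1) * exp (x / 2))))
    (Itilde (Cdiv mu (RtoC 2)) (RtoC (t * x / (2 * (1 - t))))))
    (Ktilde (INR l + / 2) (x / (2 * (1 - t)))).

Definition M (mu : C) (l j : nat) (x : R) : C :=
  Cmult (Cdiv (CGamma (Cplus (RtoC (INR j)) (Cplus mu (RtoC 1))))
              (Cmult (Cmult (RtoC (INR (Factorial.fact j))) (rcpow 2 mu))
                     (CGamma (Cplus (RtoC (INR j)) (Cdiv (Cplus mu (RtoC 1)) (RtoC 2))))))
        (Cderive_n (fun t => G mu l t x) j 0).

(* Main.v *)
Require Import Defs.
From Stdlib Require Import Reals Lra Lia.
From Coquelicot Require Import Coquelicot.

(** For half-integer order, [z^(2l+1) K~_(l+1/2) (2z)] is [exp (-2z)] times a polynomial of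
    degree [l] in [z].  The substitution [s = t x / (1 - t)] therefore turns [G] into a finite sum
    over [k <= l] of constants times
      [x^k (1 - t)^-(b + k) F (s)], with [b = (mu+1)/2 - l] and [F (y) = exp (-y/2) I~_(mu/2) (y/2)].
    If [F (y) = sum_m a_m y^m], the coefficient of [t^j] in such a summand is
    [x^k sum_(m <= j) a_m x^m (b + k + m)_(j-m) / (j-m)!], so the term [k = m = 0] gives the constant
    coefficient and the term [k = l], [m = j] the top one.  Kummer's second formula
    evaluates [a_j], and the Legendre duplication formula, obtained with the constant [sqrt PI] from
    Gauss' product and Wallis' integrals, reduces the top coefficient to [(-1)^j / j!]. *)

(** Gamma, [I] and [K] are given through [real] values of limits and series, which are defined even
    under divergence, so every identity for them has to rest on a convergence proof. For Gamma this
    is an infinite product with factors [1 + O(1/n^2)]; functional equation, nonvanishing and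
    duplication are then read off from the Gauss sequence itself. The substitution works because,
    with [z = x / (4 (1 - t))], one has [x/2 - 2 z = - s/2]: the factor [exp (x/2)] of [G] and the
    exponential of [K] merge into a function of [s] alone, and precisely this factor turns the
    series of [I~] into one with a two-term recurrence. Each power of [z] brings one more
    [(1 - t)^-1], whence [b + k]. Differential equations appear only as identities between
    coefficient sequences, where no convergence is at stake. As [t] and [x] are real, complex
    functions are treated as pairs of real ones. *)

(** * Complex numbers and limits taken by components *)

Lemma C_eq (a b : C) : Re a = Re b -> Im a = Im b -> a = b.
Proof. destruct a, b; simpl; congruence. Qed.

Lemma Re_mult (a b : C) : Re (a * b)%C = Re a * Re b - Im a * Im b.
Proof. reflexivity. Qed.
Lemma Im_mult (a b : C) : Im (a * b)%C = Re a * Im b + Im a * Re b.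
Proof. reflexivity. Qed.
Lemma Re_plus (a b : C) : Re (a + b)%C = Re a + Re b.
Proof. reflexivity. Qed.
Lemma Im_plus (a b : C) : Im (a + b)%C = Im a + Im b.
Proof. reflexivity. Qed.

Lemma Im_le_Cmod (c : C) : Rabs (Im c) <= Cmod c.
Proof.
  apply Rle_trans with (2 := Rmax_Cmod c). apply Rmax_r.
Qed.

Lemma Cmod_le_Re_Im (c : C) : Cmod c <= Rabs (Re c) + Rabs (Im c).
Proof.
  destruct c as [a b]. unfold Cmod; simpl fst; simpl snd.
  apply Rsqr_incr_0_var.
  - rewrite Rsqr_sqrt by nra. unfold Rsqr; simpl.
    assert (a * a = Rabs a * Rabs a) by (rewrite <- Rabs_mult, Rabs_pos_eq; nra).
    assert (b * b = Rabs b * Rabs b) by (rewrite <- Rabs_mult, Rabs_pos_eq; nra).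
    pose proof (Rabs_pos a). pose proof (Rabs_pos b). nra.
  - pose proof (Rabs_pos a). pose proof (Rabs_pos b). simpl; lra.
Qed.

Lemma RtoC_neq0 (x : R) : x <> 0 -> RtoC x <> RtoC 0.
Proof. intros H E. apply H. now apply RtoC_inj. Qed.

(** [Clim_seq] returns a value for every sequence; this relation records that both components really
    converge to finite limits. *)
Definition is_Clim (u : nat -> C) (l : C) : Prop :=
  is_lim_seq (fun n => Re (u n)) (Re l) /\ is_lim_seq (fun n => Im (u n)) (Im l).

Lemma is_Clim_unique (u : nat -> C) (l : C) : is_Clim u l -> Clim_seq u = l.
Proof.
  intros [H1 H2]. unfold Clim_seq. apply is_lim_seq_unique in H1, H2.
  rewrite H1, H2. now destruct l.
Qed.

Lemma is_Clim_ext_loc (u v : nat -> C) (l : C) :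
  eventually (fun n => u n = v n) -> is_Clim u l -> is_Clim v l.
Proof.
  intros [N HN] [H1 H2]. split;
  [eapply is_lim_seq_ext_loc; [|exact H1] | eapply is_lim_seq_ext_loc; [|exact H2]];
  exists N; intros n Hn; now rewrite HN.
Qed.

Lemma is_Clim_mult (u v : nat -> C) (a b : C) :
  is_Clim u a -> is_Clim v b -> is_Clim (fun n => u n * v n)%C (a * b)%C.
Proof.
  intros [H1 H2] [H3 H4]. split.
  - apply is_lim_seq_minus'; now apply (is_lim_seq_mult' _ _).
  - apply is_lim_seq_plus'; now apply (is_lim_seq_mult' _ _).
Qed.

Lemma is_Clim_const (a : C) : is_Clim (fun _ => a) a.
Proof. split; apply is_lim_seq_const. Qed.

Lemma is_Clim_plus (u v : nat -> C) (a b : C) :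
  is_Clim u a -> is_Clim v b -> is_Clim (fun n => u n + v n)%C (a + b)%C.
Proof.
  intros [H1 H2] [H3 H4]. split; now apply (is_lim_seq_plus' _ _).
Qed.

Lemma is_Clim_RtoC (u : nat -> R) (l : R) :
  is_lim_seq u l -> is_Clim (fun n => RtoC (u n)) (RtoC l).
Proof. intros H; split; [exact H | apply is_lim_seq_const]. Qed.

Lemma is_Clim_subseq (u : nat -> C) (l : C) (phi : nat -> nat) :
  filterlim phi eventually eventually -> is_Clim u l -> is_Clim (fun n => u (phi n)) l.
Proof.
  intros Hphi [H1 H2].
  split; [apply (is_lim_seq_subseq (fun n => Re (u n))) | apply (is_lim_seq_subseq (fun n => Im (u n)))]; assumption.
Qed.

Lemma is_Clim_incr_n (u : nat -> C) (N : nat) (l : C) :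
  is_Clim u l <-> is_Clim (fun n => u (n + N)%nat) l.
Proof.
  split; intros [H1 H2]; split.
  - now apply (is_lim_seq_incr_n (fun n => Re (u n))).
  - now apply (is_lim_seq_incr_n (fun n => Im (u n))).
  - now apply (is_lim_seq_incr_n (fun n => Re (u n)) N).
  - now apply (is_lim_seq_incr_n (fun n => Im (u n)) N).
Qed.

Lemma is_Clim_eq (u : nat -> C) (a b : C) : is_Clim u a -> is_Clim u b -> a = b.
Proof.
  intros H1 H2. rewrite <- (is_Clim_unique _ _ H1). now apply is_Clim_unique.
Qed.

(** * The complex exponential *)

Lemma cexp_plus (a b : C) : cexp (a + b)%C = (cexp a * cexp b)%C.
Proof.
  unfold cexp. apply C_eq; simpl; unfold Re, Im; rewrite exp_plus.
  - rewrite cos_plus. simpl. ring.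
  - rewrite sin_plus. simpl. ring.
Qed.

Lemma cexp_RtoC (x : R) : cexp (RtoC x) = RtoC (exp x).
Proof. unfold cexp; apply C_eq; simpl; rewrite ?cos_0, ?sin_0; ring. Qed.

Lemma cexp_neq0 (w : C) : cexp w <> RtoC 0.
Proof.
  intros H. assert (E : (cexp w * cexp (- w))%C = RtoC 1).
  { rewrite <- cexp_plus. replace (w + - w)%C with (RtoC 0) by ring.
    rewrite cexp_RtoC. now rewrite exp_0. }
  rewrite H, Cmult_0_l in E. apply RtoC_inj in E. lra.
Qed.

(** Only [1 + x <= exp x] is used: at [a] it gives the lower bound, at [- a] it gives
    [exp a * (1 - a) <= 1], and [1 / (1 - a) <= 1 + a + 2 a^2] for [|a| <= 1/2]. *)
Lemma exp_taylor1 (a : R) : Rabs a <= / 2 -> Rabs (exp a - 1 - a) <= 2 * (a * a).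
Proof.
  intros H. apply Rabs_le_between in H.
  pose proof (exp_ineq1_le a). pose proof (exp_ineq1_le (- a)).
  assert (exp a * exp (- a) = 1) by (rewrite <- exp_plus, Rplus_opp_r; apply exp_0).
  pose proof (exp_pos a). rewrite Rabs_pos_eq by lra.
  assert (exp a * (1 - a) <= 1) by nra.
  nra.
Qed.


(** The mean value theorem gives this bound from [|cos| <= 1]; it then feeds the bound for
    [cos b - 1], which in turn feeds the one for [sin b - b]. *)
Lemma Rabs_sin_le (b : R) : Rabs (sin b) <= Rabs b.
Proof.
  destruct (MVT_cor4 sin cos 0 (Rabs b)) with (b := b) as [c [E _]].
  - intros c _. auto_derive; [easy | ring].
  - rewrite Rminus_0_r; lra.
  - rewrite sin_0, !Rminus_0_r in E. rewrite E, Rabs_mult.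
    assert (Rabs (cos c) <= 1) by (apply Rabs_le_between; apply COS_bound).
    pose proof (Rabs_pos b). nra.
Qed.

Lemma cos_taylor1 (b : R) : Rabs (cos b - 1) <= b * b.
Proof.
  destruct (MVT_cor4 cos (fun x => - sin x) 0 (Rabs b)) with (b := b) as [c [E Hc]].
  - intros c _. auto_derive; [easy | ring].
  - rewrite Rminus_0_r; lra.
  - rewrite cos_0, !Rminus_0_r in *. rewrite E, Rabs_mult, Rabs_Ropp.
    pose proof (Rabs_sin_le c). pose proof (Rabs_pos b). pose proof (Rabs_pos (sin c)).
    assert (b * b = Rabs b * Rabs b) by (rewrite <- Rabs_mult, Rabs_pos_eq; nra).
    nra.
Qed.

Lemma sin_taylor1 (b : R) : Rabs b <= 1 -> Rabs (sin b - b) <= b * b.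
Proof.
  intros Hb.
  destruct (MVT_cor4 (fun x => sin x - x) (fun x => cos x - 1) 0 (Rabs b))
    with (b := b) as [c [E Hc]].
  - intros c _. auto_derive; [easy | ring].
  - rewrite Rminus_0_r; lra.
  - rewrite sin_0, !Rminus_0_r in *. rewrite E, Rabs_mult.
    pose proof (cos_taylor1 c). pose proof (Rabs_pos b). pose proof (Rabs_pos c).
    assert (b * b = Rabs b * Rabs b) by (rewrite <- Rabs_mult, Rabs_pos_eq; nra).
    assert (c * c = Rabs c * Rabs c) by (rewrite <- Rabs_mult, Rabs_pos_eq; nra).
    assert (Rabs c * Rabs c <= Rabs b * 1) by nra.
    nra.
Qed.

(** For [w = a + i b] the real part of the error is at most [2 a^2 + 2 b^2] and the imaginary part
    at most [b^2 + 2 |a| |b| <= a^2 + 2 b^2]; together they stay below [4 (a^2 + b^2)]. *)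
Lemma cexp_taylor1 (w : C) : Cmod w <= / 2 ->
  Cmod (cexp w - (1 + w))%C <= 4 * Cmod w ^ 2.
Proof.
  intros Hw. rewrite Cmod2_alt.
  pose proof (Rle_trans _ _ _ (re_le_Cmod w) Hw) as Ha.
  pose proof (Rle_trans _ _ _ (Im_le_Cmod w) Hw) as Hb.
  apply Rle_trans with (1 := Cmod_le_Re_Im _).
  destruct w as [a b]; simpl in *. unfold Re, Im in *; simpl in *.
  pose proof (exp_taylor1 a Ha) as H1. pose proof (cos_taylor1 b) as H2.
  assert (Hb' : Rabs b <= 1) by lra. pose proof (sin_taylor1 b Hb') as H3.
  pose proof (Rabs_sin_le b) as H4.
  assert (b * b = Rabs b * Rabs b) by (rewrite <- Rabs_mult, Rabs_pos_eq; nra).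
  assert (a * a = Rabs a * Rabs a) by (rewrite <- Rabs_mult, Rabs_pos_eq; nra).
  pose proof (Rabs_pos a). pose proof (Rabs_pos b). pose proof (Rabs_pos (sin b)).
  pose proof (Rabs_pos (cos b - 1)).
  pose proof (exp_pos a).
  assert (He : exp a <= 2) by (apply Rabs_le_between in H1; pose proof (Rle_abs a);
    assert (Rabs a * Rabs a <= / 2 * / 2) by (apply Rmult_le_compat; lra); lra).
  assert (He1 : Rabs (exp a - 1) <= 2 * Rabs a).
  { replace (exp a - 1) with ((exp a - 1 - a) + a) by ring.
    apply Rle_trans with (1 := Rabs_triang _ _).
    assert (Rabs a * Rabs a <= / 2 * Rabs a) by (apply Rmult_le_compat_r; lra). lra. }
  replace (exp a * cos b + - (1 + a)) with ((exp a - 1 - a) + exp a * (cos b - 1)) by ring.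
  replace (exp a * sin b + - (0 + b)) with ((sin b - b) + (exp a - 1) * sin b) by ring.
  assert (A1 : Rabs ((exp a - 1 - a) + exp a * (cos b - 1)) <= 2 * (a * a) + 2 * (b * b)).
  { apply Rle_trans with (1 := Rabs_triang _ _). rewrite Rabs_mult, (Rabs_pos_eq (exp a)) by lra.
    assert (exp a * Rabs (cos b - 1) <= 2 * (b * b)) by (apply Rmult_le_compat; lra). lra. }
  assert (A2 : Rabs ((sin b - b) + (exp a - 1) * sin b) <= b * b + 2 * Rabs a * Rabs b).
  { apply Rle_trans with (1 := Rabs_triang _ _). rewrite Rabs_mult.
    assert (Rabs (exp a - 1) * Rabs (sin b) <= 2 * Rabs a * Rabs b)
      by (apply Rmult_le_compat; auto using Rabs_pos). apply Rplus_le_compat; assumption. }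
  pose proof (Rle_0_sqr (Rabs a - Rabs b)) as Hsq. unfold Rsqr in Hsq. nra.
Qed.

Lemma rcpow_plus (a : R) (z w : C) : rcpow a (z + w)%C = (rcpow a z * rcpow a w)%C.
Proof. unfold rcpow. rewrite <- cexp_plus. f_equal. ring. Qed.

Lemma rcpow_neq0 (a : R) (z : C) : rcpow a z <> RtoC 0.
Proof. apply cexp_neq0. Qed.

Lemma rcpow_RtoC (a s : R) : rcpow a (RtoC s) = RtoC (Rpower a s).
Proof. unfold rcpow, Rpower. now rewrite <- RtoC_mult, cexp_RtoC. Qed.

Lemma rcpow_mult_base (a b : R) (z : C) : 0 < a -> 0 < b ->
  rcpow (a * b) z = (rcpow a z * rcpow b z)%C.
Proof.
  intros Ha Hb. unfold rcpow. rewrite <- cexp_plus, ln_mult by assumption.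
  f_equal. rewrite RtoC_plus. ring.
Qed.

Lemma rcpow_1 (a : R) : 0 < a -> rcpow a (RtoC 1) = RtoC a.
Proof. intros Ha. now rewrite rcpow_RtoC, Rpower_1. Qed.

Lemma rcpow_0 (a : R) : rcpow a (RtoC 0) = RtoC 1.
Proof. unfold rcpow. rewrite Cmult_0_l, cexp_RtoC. now rewrite exp_0. Qed.

Lemma rcpow_opp (a : R) (z : C) : rcpow a (- z)%C = (/ rcpow a z)%C.
Proof.
  assert (H : (rcpow a z * rcpow a (- z))%C = RtoC 1).
  { rewrite <- rcpow_plus. replace (z + - z)%C with (RtoC 0) by ring. apply rcpow_0. }
  pose proof (rcpow_neq0 a z).
  replace (rcpow a (- z)%C) with (/ rcpow a z * (rcpow a z * rcpow a (- z)))%C by (field; assumption).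
  rewrite H. ring.
Qed.

(** * Infinite products *)

(** The majorant [1 / ((n + 1) (n + 2))] plays the part of [1 / n^2]: it telescopes, so its partial
    sums are explicit. *)
Lemma ex_series_telescope (B : R) :
  ex_series (fun n => B * (/ (INR n + 1) - / (INR n + 2))).
Proof.
  apply (ex_series_scal B (fun n => / (INR n + 1) - / (INR n + 2))).
  exists 1. change (is_lim_seq (sum_n (fun n => / (INR n + 1) - / (INR n + 2))) 1).
  apply (is_lim_seq_ext (fun n => 1 - / (INR n + 2))).
  - intros n. induction n.
    + rewrite sum_O. simpl. field.
    + rewrite sum_Sn, <- IHn.
      change (1 - / (INR (S n) + 2) = 1 - / (INR n + 2) + (/ (INR (S n) + 1) - / (INR (S n) + 2))).
      rewrite S_INR. replace (INR n + 1 + 1) with (INR n + 2) by ring. ring.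
  - replace (Finite 1) with (Rbar_minus 1 0) by (simpl; f_equal; ring).
    apply is_lim_seq_minus'; [apply is_lim_seq_const|].
    replace (Finite 0) with (Rbar_inv p_infty) by reflexivity.
    apply is_lim_seq_inv; [|easy].
    apply is_lim_seq_plus with p_infty 2; [apply is_lim_seq_INR | apply is_lim_seq_const | easy].
Qed.

Lemma ex_lim_seq_summable_increments (f : nat -> R) (B : R) :
  (forall n, Rabs (f (S n) - f n) <= B * (/ (INR n + 1) - / (INR n + 2))) ->
  exists l : R, is_lim_seq f l.
Proof.
  intros H.
  assert (S : ex_series (fun n => f (S n) - f n)).
  { apply (ex_series_le (fun n => f (S n) - f n) (fun n => B * (/ (INR n + 1) - / (INR n + 2)))).
    - exact H.
    - apply ex_series_telescope. }
  destruct S as [l Hl]. exists (l + f O).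
  apply is_lim_seq_incr_1.
  apply (is_lim_seq_ext (fun n => sum_n (fun k => f (S k) - f k) n + f O)).
  - intros n. induction n.
    + rewrite sum_O. ring.
    + rewrite sum_Sn. change plus with Rplus. lra.
  - apply is_lim_seq_plus'; [exact Hl | apply is_lim_seq_const].
Qed.

(** Since [|1 + a n| <= exp |a n|] and the majorant telescopes, [u] is bounded by [|u 0| exp K]. The
    increments [u n * a n] are then summable. *)
Lemma Clim_product (u a : nat -> C) (K : R) :
  (forall n, u (S n) = u n * (1 + a n))%C ->
  (forall n, Cmod (a n) <= K * (/ (INR n + 1) - / (INR n + 2))) ->
  exists l, is_Clim u l.
Proof.
  intros Hu Ha.
  assert (Hpos : forall n, 0 < / (INR n + 1) - / (INR n + 2)).
  { intros n. pose proof (pos_INR n).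
    replace (/ (INR n + 1) - / (INR n + 2)) with (/ ((INR n + 1) * (INR n + 2))) by (field; lra).
    apply Rinv_0_lt_compat. nra. }
  assert (HK : 0 <= K).
  { pose proof (Ha O) as H. pose proof (Cmod_ge_0 (a O)). pose proof (Hpos O). nra. }
  assert (Hb : forall n, Cmod (u n) <= Cmod (u O) * exp (K * (1 - / (INR n + 1)))).
  { induction n.
    - simpl. replace (K * (1 - / (0 + 1))) with 0 by field. rewrite exp_0. lra.
    - rewrite Hu, Cmod_mult.
      replace (K * (1 - / (INR (S n) + 1))) with
        (K * (1 - / (INR n + 1)) + K * (/ (INR n + 1) - / (INR n + 2))).
      2:{ rewrite S_INR. pose proof (pos_INR n). field. lra. }
      rewrite exp_plus, <- Rmult_assoc.
      apply Rmult_le_compat; try apply Cmod_ge_0; [exact IHn|].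
      apply Rle_trans with (1 := Cmod_triangle _ _). rewrite Cmod_1.
      apply Rle_trans with (2 := exp_ineq1_le _). specialize (Ha n). lra. }
  set (B := Cmod (u O) * exp K).
  assert (HB : forall n, Cmod (u n) <= B).
  { intros n. apply Rle_trans with (1 := Hb n). apply Rmult_le_compat_l; [apply Cmod_ge_0|].
    assert (0 < / (INR n + 1)) by (apply Rinv_0_lt_compat; pose proof (pos_INR n); lra).
    assert (Hle : K * (1 - / (INR n + 1)) <= K) by nra.
    destruct Hle as [Hlt | ->]; [left; now apply exp_increasing | lra]. }
  assert (Hinc : forall n, Cmod (u n * a n)%C <= B * K * (/ (INR n + 1) - / (INR n + 2))).
  { intros n. rewrite Cmod_mult, Rmult_assoc.
    apply Rmult_le_compat; auto using Cmod_ge_0. }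
  destruct (ex_lim_seq_summable_increments (fun n => Re (u n)) (B * K)) as [l1 H1].
  { intros n. rewrite Hu. replace (Re (u n * (1 + a n))%C - Re (u n)) with (Re (u n * a n)%C).
    - apply Rle_trans with (1 := re_le_Cmod _), Hinc.
    - rewrite !Re_mult, Re_plus, Im_plus, re_RtoC, im_RtoC. ring. }
  destruct (ex_lim_seq_summable_increments (fun n => Im (u n)) (B * K)) as [l2 H2].
  { intros n. rewrite Hu. replace (Im (u n * (1 + a n))%C - Im (u n)) with (Im (u n * a n)%C).
    - apply Rle_trans with (1 := Im_le_Cmod _), Hinc.
    - rewrite !Im_mult, Re_plus, Im_plus, re_RtoC, im_RtoC. ring. }
  exists (l1, l2). now split.
Qed.

Lemma Clim_product_neq0 (u a : nat -> C) (K : R) :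
  u O <> RtoC 0 ->
  (forall n, u (S n) = u n * (1 + a n))%C ->
  (forall n, Cmod (a n) <= / 2) ->
  (forall n, Cmod (a n) <= K * (/ (INR n + 1) - / (INR n + 2))) ->
  exists l, is_Clim u l /\ l <> RtoC 0.
Proof.
  intros H0 Hu Hhalf Ha.
  destruct (Clim_product u a K Hu Ha) as [l Hl]. exists l; split; [exact Hl|].
  (* This lower bound is what costs the factor 2 in the constant [2 * K] for the factors of the
     inverse product. *)
  assert (Hm : forall n, / 2 <= Cmod (1 + a n)%C).
  { intros n. pose proof (Cmod_triangle (1 + a n) (- a n))%C as H.
    replace (1 + a n + - a n)%C with (RtoC 1) in H by ring.
    rewrite Cmod_1, Cmod_opp in H. specialize (Hhalf n). lra. }
  assert (H1 : forall n, (1 + a n)%C <> RtoC 0).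
  { intros n. apply Cmod_gt_0. specialize (Hm n). lra. }
  assert (Hnz : forall n, u n <> RtoC 0).
  { induction n; [exact H0|]. rewrite Hu. now apply Cmult_neq_0. }
  (* The inverses satisfy a recurrence of the same kind, so they converge too. *)
  destruct (Clim_product (fun n => / u n)%C (fun n => - a n / (1 + a n))%C (2 * K)) as [m Hm'].
  - intros n. rewrite Hu. specialize (H1 n). specialize (Hnz n). field. split; assumption.
  - intros n. rewrite Cmod_div, Cmod_opp by apply H1. specialize (Hm n). specialize (Ha n).
    pose proof (Cmod_ge_0 (a n)).
    apply Rle_div_l; [lra|]. nra.
  - intros E. subst l.
    pose proof (is_Clim_mult _ _ _ _ Hl Hm') as P.
    assert (Q : is_Clim (fun n => u n * / u n)%C (RtoC 1)).
    { apply (is_Clim_ext_loc (fun _ => RtoC 1)); [|apply is_Clim_const].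
      exists O; intros n _. symmetry; apply Cinv_r, Hnz. }
    pose proof (is_Clim_eq _ _ _ P Q) as F. rewrite Cmult_0_l in F.
    apply RtoC_inj in F. lra.
Qed.

(** * The reciprocal Gamma function *)

(** [1 + x <= exp x] at [ln (1 - h)] and at its opposite encloses [ln (1 - h)] between
    [- h / (1 - h)] and [- h]. *)
Lemma ln_1m_taylor (h : R) : 0 <= h <= / 2 ->
  Rabs (ln (1 - h)) <= 2 * h /\ Rabs (h + ln (1 - h)) <= 2 * h ^ 2.
Proof.
  intros Hh.
  assert (H1 : ln (1 - h) <= - h).
  { pose proof (exp_ineq1_le (ln (1 - h))) as E. rewrite exp_ln in E; lra. }
  assert (H2 : - (h / (1 - h)) <= ln (1 - h)).
  { pose proof (exp_ineq1_le (- ln (1 - h))) as E.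
    rewrite <- ln_Rinv, exp_ln in E by (try apply Rinv_0_lt_compat; lra).
    rewrite ln_Rinv in E by lra.
    replace (h / (1 - h)) with (/ (1 - h) - 1) by (field; lra). lra. }
  assert (H3 : h / (1 - h) <= h + 2 * h ^ 2).
  { apply Rle_div_l; [lra|]. assert (0 <= h * h * (/ 2 - h)) by (apply Rmult_le_pos; nra). nra. }
  assert (h * h <= / 2 * h) by nra.
  split; apply Rabs_le_between; lra.
Qed.

(** The first-order terms cancel, as [ln (1 - 1/m)] is [-1/m] up to [O(1/m^2)]. In the constant,
    [2 |z|] comes from the remainder of the logarithm, [2 |z|^2] from the product of the two linear
    terms and [32 |z|^2] from the remainder of the exponential. *)
Lemma gauss_factor_bound (z : C) : exists K, forall m : R, 2 <= m -> 4 * Cmod z <= m ->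
  Cmod ((1 + z / RtoC m) * cexp (z * RtoC (ln (1 - / m))) - 1)%C <= K / m ^ 2.
Proof.
  exists (2 * Cmod z + 34 * Cmod z ^ 2). intros m Hm Hz.
  set (h := / m).
  assert (Hh : 0 < h <= / 2).
  { unfold h. split; [apply Rinv_0_lt_compat; lra | apply Rinv_le_contravar; lra]. }
  destruct (ln_1m_taylor h) as [L1 L2]; [lra|].
  set (w := (z * RtoC (ln (1 - h)))%C). set (E := (cexp w - (1 + w))%C).
  replace ((1 + z / RtoC m) * cexp w - 1)%C with
    (z * RtoC (h + ln (1 - h)) + (z * RtoC h * w + (1 + z * RtoC h) * E))%C.
  2:{ unfold E, w, h. rewrite RtoC_plus, RtoC_inv by lra.
      field. apply RtoC_neq0; lra. }
  assert (Zh : Cmod z * h <= / 4).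
  { replace (/ 4) with (m / 4 * h) by (unfold h; field; lra).
    apply Rmult_le_compat_r; lra. }
  pose proof (Cmod_ge_0 z) as Z0.
  assert (Hw : Cmod w <= 2 * (Cmod z * h)).
  { unfold w. rewrite Cmod_mult, Cmod_R.
    apply Rle_trans with (Cmod z * (2 * h)); [apply Rmult_le_compat_l; lra | lra]. }
  pose proof (Cmod_ge_0 w) as W0.
  assert (HE : Cmod E <= 16 * (Cmod z * h) ^ 2).
  { apply Rle_trans with (1 := cexp_taylor1 w ltac:(lra)).
    apply Rle_trans with (4 * (2 * (Cmod z * h)) ^ 2); [|lra].
    apply Rmult_le_compat_l; [lra|]. apply pow_incr; lra. }
  replace ((2 * Cmod z + 34 * Cmod z ^ 2) / m ^ 2) with
    (Cmod z * (2 * h ^ 2) + ((Cmod z * h) * (2 * (Cmod z * h)) + 2 * (16 * (Cmod z * h) ^ 2))).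
  2:{ unfold h. field. lra. }
  apply Rle_trans with (1 := Cmod_triangle _ _). apply Rplus_le_compat.
  { rewrite Cmod_mult, Cmod_R. now apply Rmult_le_compat_l. }
  apply Rle_trans with (1 := Cmod_triangle _ _).
  assert (Hzh : Cmod (z * RtoC h)%C = Cmod z * h).
  { now rewrite Cmod_mult, Cmod_R, Rabs_pos_eq by lra. }
  apply Rplus_le_compat.
  - rewrite Cmod_mult, Hzh. apply Rmult_le_compat_l; [nra | lra].
  - rewrite Cmod_mult. apply Rmult_le_compat; auto using Cmod_ge_0.
    apply Rle_trans with (1 := Cmod_triangle _ _). rewrite Cmod_1, Hzh. lra.
Qed.

Definition gauss (z : C) (n : nat) : C :=
  Cdiv (poch z (S n)) (Cmult (RtoC (INR (Factorial.fact n))) (rcpow (INR n) z)).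

Lemma poch_S (z : C) (n : nat) : poch z (S n) = (poch z n * (z + RtoC (INR n)))%C.
Proof. reflexivity. Qed.

Lemma poch_0 (z : C) : poch z 0 = RtoC 1.
Proof. reflexivity. Qed.

Lemma poch_S_l (z : C) (n : nat) : poch z (S n) = (z * poch (z + 1) n)%C.
Proof.
  induction n.
  - rewrite poch_S, !poch_0. simpl INR. ring.
  - rewrite poch_S, IHn, poch_S. rewrite S_INR, RtoC_plus. ring.
Qed.

Lemma poch_neq0 (z : C) (n : nat) :
  (forall k : nat, z <> RtoC (- INR k)) -> poch z n <> RtoC 0.
Proof.
  intros H. induction n.
  - rewrite poch_0. apply C1_nz.
  - rewrite poch_S. apply Cmult_neq_0; [exact IHn|].
    intros E. apply (H n). rewrite RtoC_opp.
    replace z with (z + RtoC (INR n) - RtoC (INR n))%C by ring. rewrite E. ring.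
Qed.

Lemma fact_neq0_C (n : nat) : RtoC (INR (Factorial.fact n)) <> RtoC 0.
Proof. apply RtoC_neq0, INR_fact_neq_0. Qed.

Lemma fact_S_C (n : nat) :
  RtoC (INR (Factorial.fact (S n))) = (RtoC (INR n + 1) * RtoC (INR (Factorial.fact n)))%C.
Proof. rewrite fact_simpl, mult_INR, S_INR. apply RtoC_mult. Qed.

Lemma INR_2 : INR 2 = 2.
Proof. simpl. ring. Qed.

Lemma INR_S_neq0_C (n : nat) : RtoC (INR n + 1) <> RtoC 0.
Proof. apply RtoC_neq0. pose proof (pos_INR n). lra. Qed.

(** The quotient of consecutive terms is [(1 + z/(n+1)) (n/(n+1))^z]. For [n = 0] a power of base 0
    would enter, where [ln] has only a default value. *)
Lemma gauss_S (z : C) (n : nat) : (1 <= n)%nat ->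
  gauss z (S n) = (gauss z n *
    ((1 + z / RtoC (INR n + 1)) * cexp (z * RtoC (ln (1 - / (INR n + 1))))))%C.
Proof.
  intros Hn. unfold gauss.
  assert (Hn' : 0 < INR n) by (apply lt_0_INR; lia).
  change (cexp (z * RtoC (ln (1 - / (INR n + 1))))) with (rcpow (1 - / (INR n + 1)) z).
  assert (E : rcpow (INR n) z = (rcpow (INR n + 1) z * rcpow (1 - / (INR n + 1)) z)%C).
  { rewrite <- rcpow_mult_base; [f_equal; field; lra | lra |].
    replace (1 - / (INR n + 1)) with (INR n / (INR n + 1)) by (field; lra).
    apply Rdiv_lt_0_compat; lra. }
  rewrite E, (poch_S z (S n)), fact_S_C, S_INR.
  pose proof (fact_neq0_C n). pose proof (INR_S_neq0_C n).
  pose proof (rcpow_neq0 (INR n + 1) z). pose proof (rcpow_neq0 (1 - / (INR n + 1)) z).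
  field. repeat split; assumption.
Qed.

Lemma gauss_tail (z : C) : exists (N : nat) (a : nat -> C) (K : R),
  (1 <= N)%nat /\
  (forall n, gauss z (S n + N)%nat = gauss z (n + N)%nat * (1 + a n))%C /\
  (forall n, Cmod (a n) <= / 2) /\
  (forall n, Cmod (a n) <= K * (/ (INR n + 1) - / (INR n + 2))).
Proof.
  destruct (gauss_factor_bound z) as [K0 HK0].
  set (K := Rmax K0 0).
  (* For [m > N] the three summands ensure [4 |z| <= m], [K / m^2 <= 1/2], and [N >= 1] together
     with [m >= 2]. *)
  destruct (INR_unbounded (4 * Cmod z + 2 * K + 1)) as [N HN].
  pose proof (Cmod_ge_0 z) as Z0. assert (K1 : 0 <= K) by apply Rmax_r.
  assert (HN1 : (1 <= N)%nat).
  { apply INR_le. simpl. lra. }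
  assert (HN2 : 1 <= INR N) by (apply (le_INR 1); exact HN1).
  exists N, (fun n => ((1 + z / RtoC (INR (n + N) + 1)) *
    cexp (z * RtoC (ln (1 - / (INR (n + N) + 1)))) - 1)%C), K.
  assert (HB : forall n, Cmod ((1 + z / RtoC (INR (n + N) + 1)) *
    cexp (z * RtoC (ln (1 - / (INR (n + N) + 1)))) - 1)%C <= K / (INR (n + N) + 1) ^ 2).
  { intros n. rewrite plus_INR. pose proof (pos_INR n).
    apply Rle_trans with (1 := HK0 (INR n + INR N + 1) ltac:(lra) ltac:(lra)).
    apply Rmult_le_compat_r; [|apply Rmax_l].
    left; apply Rinv_0_lt_compat, pow_lt; lra. }
  repeat split; [exact HN1 | | |].
  - intros n. replace (S n + N)%nat with (S (n + N)) by lia.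
    rewrite gauss_S by lia. f_equal. ring.
  - intros n. apply Rle_trans with (1 := HB n). rewrite plus_INR. pose proof (pos_INR n).
    apply Rle_div_l; [apply pow_lt; lra|]. nra.
  - intros n. apply Rle_trans with (1 := HB n). rewrite plus_INR. pose proof (pos_INR n).
    replace (/ (INR n + 1) - / (INR n + 2)) with (/ ((INR n + 1) * (INR n + 2))) by (field; lra).
    apply Rmult_le_compat_l; [exact K1|]. apply Rinv_le_contravar; nra.
Qed.

Lemma rgamma_Clim (z : C) : is_Clim (gauss z) (rgamma z).
Proof.
  destruct (gauss_tail z) as (N & a & K & HN & Hu & _ & Ha).
  destruct (Clim_product (fun n => gauss z (n + N)%nat) a K Hu Ha) as [l Hl].
  apply <- is_Clim_incr_n in Hl.
  replace (rgamma z) with l; [exact Hl|]. symmetry. exact (is_Clim_unique _ _ Hl).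
Qed.

Lemma gauss_neq0 (z : C) (n : nat) :
  (forall k : nat, z <> RtoC (- INR k)) -> gauss z n <> RtoC 0.
Proof.
  intros Hz H. unfold gauss in H. pose proof (poch_neq0 z (S n) Hz) as P. apply P.
  assert (D : (RtoC (INR (Factorial.fact n)) * rcpow (INR n) z)%C <> RtoC 0)
    by (apply Cmult_neq_0; [apply fact_neq0_C | apply rcpow_neq0]).
  replace (poch z (S n)) with
    (poch z (S n) / (RtoC (INR (Factorial.fact n)) * rcpow (INR n) z)
     * (RtoC (INR (Factorial.fact n)) * rcpow (INR n) z))%C by (field; split;
     [apply rcpow_neq0 | apply fact_neq0_C]).
  rewrite H. ring.
Qed.

(** Away from the poles of Gamma no term of the Gauss sequence vanishes, and from some index on the
    sequence is a product with summable perturbations of size at most 1/2. *)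
Lemma rgamma_neq0 (z : C) : (forall k : nat, z <> RtoC (- INR k)) -> rgamma z <> RtoC 0.
Proof.
  intros Hz. destruct (gauss_tail z) as (N & a & K & HN & Hu & Hh & Ha).
  destruct (Clim_product_neq0 (fun n => gauss z (n + N)%nat) a K) as [l [Hl Hnz]];
    [now apply gauss_neq0 | exact Hu | exact Hh | exact Ha |].
  apply <- is_Clim_incr_n in Hl. now rewrite (is_Clim_eq _ _ _ (rgamma_Clim z) Hl).
Qed.

Lemma is_lim_seq_INR_shift_div (c : R) :
  is_lim_seq (fun n => (INR n + c) / INR n) 1.
Proof.
  apply (is_lim_seq_ext_loc (fun n => 1 + c * / INR n)).
  { exists 1%nat. intros n Hn. apply (le_INR 1) in Hn. simpl in Hn. field. lra. }
  replace (Finite 1) with (Finite (1 + c * 0)) by (f_equal; ring).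
  apply is_lim_seq_plus'; [apply is_lim_seq_const|].
  apply is_lim_seq_mult'; [apply is_lim_seq_const|].
  replace (Finite 0) with (Rbar_inv p_infty) by reflexivity.
  apply is_lim_seq_inv; [apply is_lim_seq_INR | easy].
Qed.

(** [z * gauss (z + 1) n] is [gauss z n] times [(n + 1 + z) / n], and this factor tends to 1. *)
Lemma rgamma_S (z : C) : rgamma z = (z * rgamma (z + 1))%C.
Proof.
  assert (L : is_Clim (fun n => z * gauss (z + 1) n)%C (z * rgamma (z + 1))%C)
    by (apply is_Clim_mult; [apply is_Clim_const | apply rgamma_Clim]).
  assert (Q : is_Clim (fun n => gauss z n * (RtoC ((INR n + 1) / INR n) + z * RtoC (/ INR n)))%C
                      (rgamma z * (1 + z * 0))%C).
  { apply is_Clim_mult; [apply rgamma_Clim|]. apply is_Clim_plus.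
    - apply is_Clim_RtoC, is_lim_seq_INR_shift_div.
    - apply is_Clim_mult; [apply is_Clim_const | apply is_Clim_RtoC].
      replace (Finite 0) with (Rbar_inv p_infty) by reflexivity.
      apply is_lim_seq_inv; [apply is_lim_seq_INR | easy]. }
  replace (rgamma z * (1 + z * 0))%C with (rgamma z) in Q by ring.
  assert (Q' : is_Clim (fun n => z * gauss (z + 1) n)%C (rgamma z)).
  { apply is_Clim_ext_loc with (2 := Q). exists 1%nat. intros n Hn.
    apply (le_INR 1) in Hn. simpl in Hn.
    unfold gauss. rewrite rcpow_plus, rcpow_1 by lra.
    replace (poch z (S n) / (RtoC (INR (Factorial.fact n)) * rcpow (INR n) z)
      * (RtoC ((INR n + 1) / INR n) + z * RtoC (/ INR n)))%C
     with (poch z (S (S n)) / (RtoC (INR (Factorial.fact n)) * (rcpow (INR n) z * RtoC (INR n))))%C.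
    2:{ rewrite (poch_S z (S n)), S_INR, RtoC_div, RtoC_inv by lra.
        pose proof (fact_neq0_C n). pose proof (rcpow_neq0 (INR n) z).
        assert (RtoC (INR n) <> RtoC 0) by (apply RtoC_neq0; lra).
        field. repeat split; assumption. }
    rewrite (poch_S_l z). unfold Cdiv. ring. }
  exact (is_Clim_eq _ _ _ Q' L).
Qed.

Lemma rgamma_poch (z : C) (n : nat) : rgamma z = (poch z n * rgamma (z + RtoC (INR n)))%C.
Proof.
  induction n.
  - rewrite poch_0. simpl INR. now rewrite Cplus_0_r, Cmult_1_l.
  - rewrite IHn, (rgamma_S (z + RtoC (INR n))), poch_S, S_INR, RtoC_plus.
    now rewrite (Cplus_assoc z), Cmult_assoc.
Qed.

(** * Wallis integrals and Legendre duplication *)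

Definition wallis (n : nat) : R := RInt (fun t => sin t ^ n) 0 (PI / 2).

Lemma ex_RInt_sin_pow (n : nat) : ex_RInt (fun t => sin t ^ n) 0 (PI / 2).
Proof.
  apply (@ex_RInt_continuous R_CompleteNormedModule). intros t _.
  apply (@ex_derive_continuous R_AbsRing R_NormedModule). auto_derive. easy.
Qed.

(** Integration by parts, carried out by integrating the derivative of [- cos t * sin t ^ (n + 1)],
    which vanishes at both ends. *)
Lemma wallis_S_S (n : nat) : (INR n + 2) * wallis (S (S n)) = (INR n + 1) * wallis n.
Proof.
  assert (H : is_RInt (fun t => (INR n + 2) * sin t ^ S (S n) - (INR n + 1) * sin t ^ n)
    0 (PI / 2) (- cos (PI / 2) * sin (PI / 2) ^ S n - - cos 0 * sin 0 ^ S n)).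
  { apply (is_RInt_derive (fun t => - cos t * sin t ^ S n)).
    - intros t _. auto_derive; [easy|].
      change (match n with O => 1 | S _ => INR n + 1 end) with (INR (S n)).
      rewrite S_INR. pose proof (sin2_cos2 t) as E. unfold Rsqr in E.
      simpl Nat.pred. simpl pow.
      transitivity (sin t * (sin t * sin t ^ n) - (INR n + 1) * (cos t * cos t) * sin t ^ n); [ring|].
      replace (cos t * cos t) with (1 - sin t * sin t) by lra. ring.
    - intros t _. apply (@ex_derive_continuous R_AbsRing R_NormedModule). auto_derive. easy. }
  rewrite cos_PI2, sin_0 in H. rewrite pow_i in H by lia.
  replace (- 0 * sin (PI / 2) ^ S n - - cos 0 * 0) with 0 in H by ring.
  assert (H2 : is_RInt (fun t => (INR n + 2) * sin t ^ S (S n) - (INR n + 1) * sin t ^ n)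
    0 (PI / 2) ((INR n + 2) * wallis (S (S n)) - (INR n + 1) * wallis n)).
  { apply (@is_RInt_minus R_NormedModule); apply (@is_RInt_scal R_NormedModule);
    apply (@RInt_correct R_CompleteNormedModule), ex_RInt_sin_pow. }
  apply (@is_RInt_unique R_CompleteNormedModule) in H, H2. rewrite H in H2. lra.
Qed.

Lemma wallis_0 : wallis 0 = PI / 2.
Proof. unfold wallis. simpl. rewrite RInt_const. unfold scal; simpl; unfold mult; simpl. ring. Qed.

Lemma wallis_1 : wallis 1 = 1.
Proof.
  unfold wallis. apply (@is_RInt_unique R_CompleteNormedModule).
  replace 1 with (- cos (PI / 2) - - cos 0) by (rewrite cos_PI2, cos_0; ring).
  apply (@is_RInt_derive R_CompleteNormedModule (fun t => - cos t)).
  - intros t _. auto_derive; [easy | ring].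
  - intros t _. apply (@ex_derive_continuous R_AbsRing R_NormedModule). auto_derive. easy.
Qed.

Lemma wallis_ge0 (n : nat) : 0 <= wallis n.
Proof.
  pose proof PI_RGT_0. apply RInt_ge_0; [lra | apply ex_RInt_sin_pow |].
  intros t Ht. apply pow_le, sin_ge_0; lra.
Qed.

Lemma wallis_decr (n : nat) : wallis (S n) <= wallis n.
Proof.
  pose proof PI_RGT_0. apply RInt_le; try apply ex_RInt_sin_pow; [lra|].
  intros t Ht. simpl. pose proof (SIN_bound t).
  assert (0 <= sin t ^ n) by (apply pow_le, sin_ge_0; lra). nra.
Qed.

(** By the recurrence the left side does not depend on [n]. *)
Lemma wallis_mult (n : nat) : (INR n + 1) * (wallis n * wallis (S n)) = PI / 2.
Proof.
  induction n.
  - rewrite wallis_0, wallis_1. simpl. ring.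
  - rewrite S_INR, <- IHn.
    replace ((INR n + 1 + 1) * (wallis (S n) * wallis (S (S n))))
      with (wallis (S n) * ((INR n + 2) * wallis (S (S n)))) by ring.
    rewrite wallis_S_S. ring.
Qed.

(** Both sides obey the same first-order recurrence. This rewrites the Gauss sequence at [1/2] in
    terms of Wallis integrals. *)
Lemma wallis_even (n : nat) :
  poch (RtoC (/ 2)) n = RtoC (2 / PI * wallis (2 * n) * INR (Factorial.fact n)).
Proof.
  pose proof PI_RGT_0. induction n.
  - rewrite poch_0. simpl Nat.mul. rewrite wallis_0. simpl. f_equal. field. lra.
  - rewrite poch_S, IHn, <- RtoC_plus, <- RtoC_mult. f_equal.
    replace (2 * S n)%nat with (S (S (2 * n))) by lia.
    pose proof (wallis_S_S (2 * n)) as E. rewrite mult_INR, INR_2 in E.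
    rewrite fact_simpl, mult_INR, S_INR. pose proof (pos_INR n).
    assert (E' : wallis (S (S (2 * n))) = (2 * INR n + 1) * wallis (2 * n) / (2 * INR n + 2)).
    { apply Rmult_eq_reg_l with (2 * INR n + 2); [|lra]. rewrite E. field. lra. }
    rewrite E'. field. lra.
Qed.

(** The square of the Gauss sequence is squeezed: monotonicity places [wallis (2n) ^ 2] between the
    products with its two neighbours, which [wallis_mult] evaluates to [PI / (4n + 2)] and
    [PI / (4n)]. So the limit has square [1 / PI], and it is nonnegative because all terms are. *)
Lemma rgamma_half : rgamma (RtoC (/ 2)) = RtoC (/ sqrt PI).
Proof.
  pose proof PI_RGT_0 as HPI.
  set (g := fun n => 2 / PI * wallis (2 * n) * (INR n + / 2) * / Rpower (INR n) (/ 2)).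
  assert (Hg : is_Clim (fun n => RtoC (g n)) (rgamma (RtoC (/ 2)))).
  { apply is_Clim_ext_loc with (2 := rgamma_Clim _). exists 1%nat. intros n Hn.
    apply (le_INR 1) in Hn. simpl in Hn. pose proof (INR_fact_neq_0 n).
    unfold gauss. rewrite poch_S, wallis_even, rcpow_RtoC, <- RtoC_plus, <- !RtoC_mult.
    assert (Rpower (INR n) (/ 2) <> 0) by (apply Rgt_not_eq, exp_pos).
    rewrite <- RtoC_div by (apply Rmult_integral_contrapositive_currified; assumption).
    unfold g. f_equal. field. repeat split; try assumption. lra. }
  destruct Hg as [H1 H2].
  assert (E2 : Im (rgamma (RtoC (/ 2))) = 0).
  { assert (Q : is_lim_seq (fun n => Im (RtoC (g n))) 0)
      by exact (is_lim_seq_const 0).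
    apply is_lim_seq_unique in H2, Q. rewrite Q in H2. now inversion H2. }
  set (r := Re (rgamma (RtoC (/ 2)))) in *.
  change (is_lim_seq g r) in H1.
  assert (R0 : 0 <= r).
  { apply (is_lim_seq_le (fun _ => 0) g 0 r); [|apply is_lim_seq_const | exact H1].
    intros n. unfold g. pose proof (wallis_ge0 (2 * n)). pose proof (pos_INR n).
    assert (0 < / Rpower (INR n) (/ 2)) by apply Rinv_0_lt_compat, exp_pos.
    assert (0 < 2 / PI) by (apply Rdiv_lt_0_compat; lra).
    repeat apply Rmult_le_pos; lra. }
  assert (R2 : r * r = / PI).
  { assert (Q : is_lim_seq (fun n => g n * g n) (r * r)) by now apply is_lim_seq_mult'.
    assert (Q' : is_lim_seq (fun n => g n * g n) (/ PI)).
    { apply (is_lim_seq_le_le_loc (fun n => / PI * ((INR n + / 2) / INR n)) _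
        (fun n => / PI * (((INR n + / 2) / INR n) * ((INR n + / 2) / INR n)))).
      - exists 1%nat. intros n Hn. pose proof (le_INR 1 n Hn) as Hn'. simpl in Hn'.
        assert (Es : Rpower (INR n) (/ 2) * Rpower (INR n) (/ 2) = INR n).
        { rewrite <- Rpower_plus. replace (/ 2 + / 2) with 1 by field. apply Rpower_1; lra. }
        assert (Hp : 0 < Rpower (INR n) (/ 2)) by apply exp_pos.
        replace (g n * g n) with
          (4 / (PI * PI) * (wallis (2 * n) * wallis (2 * n)) * ((INR n + / 2) * (INR n + / 2) / INR n)).
        2:{ unfold g. rewrite <- Es at 3. field. lra. }
        pose proof (wallis_decr (2 * n)) as D1. pose proof (wallis_mult (2 * n)) as M1.
        pose proof (wallis_ge0 (2 * n)) as P1.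
        (* Here [n >= 1] makes the truncated difference [2 * n - 1] the true predecessor. *)
        pose proof (wallis_decr (2 * n - 1)) as D2. pose proof (wallis_mult (2 * n - 1)) as M2.
        replace (S (2 * n - 1)) with (2 * n)%nat in * by lia.
        rewrite minus_INR in M2 by lia. rewrite mult_INR, INR_2 in M1, M2. rewrite INR_1 in M2.
        assert (B1 : PI / (4 * INR n + 2) <= wallis (2 * n) * wallis (2 * n)).
        { apply Rle_div_l; [lra|].
          assert (wallis (2 * n) * wallis (S (2 * n)) <= wallis (2 * n) * wallis (2 * n))
            by (apply Rmult_le_compat_l; lra).
          assert ((2 * INR n + 1) * (wallis (2 * n) * wallis (S (2 * n))) <=
            (2 * INR n + 1) * (wallis (2 * n) * wallis (2 * n)))
            by (apply Rmult_le_compat_l; lra). lra. }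
        assert (B2 : wallis (2 * n) * wallis (2 * n) <= PI / (4 * INR n)).
        { assert (H4n : 0 < 4 * INR n) by lra. apply (Rle_div_r _ _ _ H4n).
          assert (wallis (2 * n) * wallis (2 * n) <= wallis (2 * n - 1) * wallis (2 * n))
            by (apply Rmult_le_compat_r; lra).
          assert ((2 * INR n - 1 + 1) * (wallis (2 * n) * wallis (2 * n)) <=
            (2 * INR n - 1 + 1) * (wallis (2 * n - 1) * wallis (2 * n)))
            by (apply Rmult_le_compat_l; lra). lra. }
        assert (C1 : 0 <= (INR n + / 2) * (INR n + / 2) / INR n).
        { apply Rmult_le_pos; [nra|]. left; apply Rinv_0_lt_compat; lra. }
        assert (C2 : 0 <= 4 / (PI * PI)).
        { apply Rmult_le_pos; [lra|]. left; apply Rinv_0_lt_compat; nra. }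
        split.
        + replace (/ PI * ((INR n + / 2) / INR n)) with
            (4 / (PI * PI) * (PI / (4 * INR n + 2)) * ((INR n + / 2) * (INR n + / 2) / INR n))
            by (field; lra).
          apply Rmult_le_compat_r; [assumption|]. now apply Rmult_le_compat_l.
        + replace (/ PI * ((INR n + / 2) / INR n * ((INR n + / 2) / INR n))) with
            (4 / (PI * PI) * (PI / (4 * INR n)) * ((INR n + / 2) * (INR n + / 2) / INR n))
            by (field; lra).
          apply Rmult_le_compat_r; [assumption|]. now apply Rmult_le_compat_l.
      - replace (Finite (/ PI)) with (Finite (/ PI * 1)) by (f_equal; ring).
        apply is_lim_seq_mult'; [apply is_lim_seq_const | apply is_lim_seq_INR_shift_div].
      - replace (Finite (/ PI)) with (Finite (/ PI * (1 * 1))) by (f_equal; ring).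
        apply is_lim_seq_mult'; [apply is_lim_seq_const |].
        apply is_lim_seq_mult'; apply is_lim_seq_INR_shift_div. }
    apply is_lim_seq_unique in Q, Q'. rewrite Q in Q'. now inversion Q'. }
  apply C_eq; [|rewrite im_RtoC; exact E2]. rewrite re_RtoC. fold r.
  rewrite <- sqrt_inv, <- R2. symmetry. apply sqrt_square, R0.
Qed.

(** The factors of the left side pair up as [(2z + 2k) (2z + 2k + 1) = 4 (z + k) (z + 1/2 + k)]. *)
Lemma poch_duplication (z : C) (n : nat) :
  poch (2 * z)%C (2 * n) = (RtoC (4 ^ n) * (poch z n * poch (z + RtoC (/ 2)) n))%C.
Proof.
  induction n.
  - simpl Nat.mul. rewrite !poch_0. simpl. ring.
  - replace (2 * S n)%nat with (S (S (2 * n))) by lia.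
    rewrite !poch_S, IHn, S_INR, mult_INR, INR_2. simpl pow.
    rewrite !RtoC_plus, !RtoC_mult, RtoC_inv by lra. field.
Qed.

Lemma is_Clim_rcpow (u : nat -> R) (a : R) (z : C) :
  0 < a -> is_lim_seq u a -> is_Clim (fun n => rcpow (u n) z) (rcpow a z).
Proof.
  intros Ha Hu.
  assert (L : is_lim_seq (fun n => ln (u n)) (ln a)).
  { apply (is_lim_seq_continuous ln u a); [|exact Hu].
    apply continuity_pt_filterlim, (@ex_derive_continuous R_AbsRing R_NormedModule).
    exists (/ a). now apply is_derive_ln. }
  unfold rcpow. destruct z as [p q]. split.
  - apply (is_lim_seq_continuous (fun t => Re (cexp ((p, q) * RtoC t)%C)) _ _); [|exact L].
    apply continuity_pt_filterlim, (@ex_derive_continuous R_AbsRing R_NormedModule).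
    unfold cexp, Re, Im; simpl. auto_derive. easy.
  - apply (is_lim_seq_continuous (fun t => Im (cexp ((p, q) * RtoC t)%C)) _ _); [|exact L].
    apply continuity_pt_filterlim, (@ex_derive_continuous R_AbsRing R_NormedModule).
    unfold cexp, Re, Im; simpl. auto_derive. easy.
Qed.

(** The product on the left is compared with the subsequence [gauss (2z) (2n + 1)], whose Pochhammer
    symbol has the even number [2n + 2] of factors. The powers differ by [((2n + 1) / n)^(2z)],
    which tends to [2^(2z)], and the factorials combine into [gauss (1/2) n]. *)
Lemma rgamma_duplication (z : C) :
  (rgamma z * rgamma (z + RtoC (/ 2)))%C =
  (rgamma (2 * z) * rcpow 2 (2 * z) * rgamma (RtoC (/ 2)) / 2)%C.
Proof.
  assert (L : is_Clim (fun n => gauss z n * gauss (z + RtoC (/ 2)) n)%C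
     (rgamma z * rgamma (z + RtoC (/ 2)))%C) by (apply is_Clim_mult; apply rgamma_Clim).
  assert (Q : is_Clim (fun n => gauss (2 * z) (2 * n + 1) *
        rcpow ((2 * INR n + 1) / INR n) (2 * z) * gauss (RtoC (/ 2)) n * RtoC (/ 2))%C
     (rgamma (2 * z) * rcpow 2 (2 * z) * rgamma (RtoC (/ 2)) * RtoC (/ 2))%C).
  { repeat apply is_Clim_mult.
    - apply (is_Clim_subseq (gauss (2 * z)) _ (fun n => 2 * n + 1)%nat); [|apply rgamma_Clim].
      apply eventually_subseq. intros n. lia.
    - apply is_Clim_rcpow; [lra|].
      apply (is_lim_seq_ext_loc (fun n => 2 * ((INR n + / 2) / INR n))).
      + exists 1%nat. intros n Hn. apply (le_INR 1) in Hn. simpl in Hn. field. lra.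
      + replace (Finite 2) with (Finite (2 * 1)) by (f_equal; ring).
        apply is_lim_seq_mult'; [apply is_lim_seq_const | apply is_lim_seq_INR_shift_div].
    - apply rgamma_Clim.
    - apply is_Clim_const. }
  unfold Cdiv. rewrite <- RtoC_inv by lra.
  apply (is_Clim_eq _ _ _ L). apply is_Clim_ext_loc with (2 := Q).
  exists 1%nat. intros n Hn. apply (le_INR 1) in Hn. simpl in Hn.
  assert (P1 : poch (RtoC 1) (S n) = RtoC (INR (Factorial.fact (S n)))).
  { generalize (S n). intros m. induction m; [reflexivity|].
    rewrite poch_S, IHm, fact_S_C, RtoC_plus. ring. }
  (* This is [poch_duplication] at [z = 1/2], where the left side is [(2n + 2)!] and one of the two
     symbols on the right is [(n + 1)!]. *)
  assert (P2 : RtoC (INR (Factorial.fact (2 * n + 1))) =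
    (RtoC (4 ^ S n) * (poch (RtoC (/ 2)) (S n) * RtoC (INR (Factorial.fact n))) / 2)%C).
  { assert (E : RtoC (INR (Factorial.fact (2 * S n))) = poch (RtoC 1) (2 * S n)).
    { generalize (2 * S n)%nat. intros m. induction m; [reflexivity|].
      rewrite poch_S, <- IHm, fact_S_C, RtoC_plus. ring. }
    replace (RtoC 1) with (2 * RtoC (/ 2))%C in E
      by (rewrite <- RtoC_mult; f_equal; field).
    rewrite poch_duplication in E.
    replace (RtoC (/ 2) + RtoC (/ 2))%C with (RtoC 1) in E
      by (rewrite <- RtoC_plus; f_equal; field).
    rewrite P1, fact_S_C in E. replace (2 * S n)%nat with (S (2 * n + 1)) in E by lia.
    rewrite fact_S_C in E. rewrite plus_INR, mult_INR, INR_2, INR_1 in E.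
    replace (2 * INR n + 1 + 1) with (2 * (INR n + 1)) in E by ring. rewrite RtoC_mult in E.
    pose proof (INR_S_neq0_C n). assert (RtoC 2 <> RtoC 0) by (apply RtoC_neq0; lra).
    apply (f_equal (fun w => w / (2 * RtoC (INR n + 1)))%C) in E.
    replace (2 * RtoC (INR n + 1) * RtoC (INR (Factorial.fact (2 * n + 1)))
             / (2 * RtoC (INR n + 1)))%C
      with (RtoC (INR (Factorial.fact (2 * n + 1)))) in E by (field; assumption).
    rewrite E. field. assumption. }
  unfold gauss. replace (S (2 * n + 1)) with (2 * S n)%nat by lia.
  rewrite poch_duplication, P2.
  replace (INR (2 * n + 1)) with (2 * INR n + 1)
    by (rewrite plus_INR, mult_INR; simpl; ring).
  assert (Hq : 0 < (2 * INR n + 1) / INR n) by (apply Rdiv_lt_0_compat; lra).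
  assert (E : rcpow (2 * INR n + 1) (2 * z) =
    (rcpow ((2 * INR n + 1) / INR n) (2 * z) * (rcpow (INR n) z * rcpow (INR n) z))%C).
  { replace (2 * z)%C with (z + z)%C by ring. rewrite <- (rcpow_plus (INR n)).
    rewrite <- rcpow_mult_base by lra. f_equal. field. lra. }
  rewrite E, (rcpow_plus (INR n) z (RtoC (/ 2))).
  assert (Hh : forall k : nat, RtoC (/ 2) <> RtoC (- INR k)).
  { intros k F. apply RtoC_inj in F. pose proof (pos_INR k). lra. }
  pose proof (poch_neq0 _ (S n) Hh). pose proof (fact_neq0_C n).
  pose proof (rcpow_neq0 (INR n) z). pose proof (rcpow_neq0 (INR n) (RtoC (/ 2))).
  pose proof (rcpow_neq0 ((2 * INR n + 1) / INR n) (2 * z)).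
  assert (RtoC (4 ^ S n) <> RtoC 0) by (apply RtoC_neq0, pow_nonzero; lra).
  set (P := poch (RtoC (/ 2)) (S n)) in *.
  set (s := rcpow (INR n) (RtoC (/ 2))) in *.
  rewrite (RtoC_inv 2) by lra.
  assert (RtoC 2 <> RtoC 0) by (apply RtoC_neq0; lra).
  field. repeat split; assumption.
Qed.

(** * Entire power series with complex coefficients *)

(** Complex coefficients but a real variable: the two components are real power series, to which the
    real theory applies. *)
Definition is_CPS (a : nat -> C) (y : R) (v : C) : Prop :=
  is_pseries (fun n => Re (a n)) y (Re v) /\ is_pseries (fun n => Im (a n)) y (Im v).

Definition CPS (a : nat -> C) (y : R) : C :=
  (PSeries (fun n => Re (a n)) y, PSeries (fun n => Im (a n)) y).

(** Convergence on the whole line gives both components infinite radius, so products and termwise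
    differentiation carry no radius conditions. *)
Definition entire (a : nat -> C) : Prop := forall y, exists v, is_CPS a y v.

Lemma is_CPS_unique (a : nat -> C) (y : R) (v : C) : is_CPS a y v -> CPS a y = v.
Proof.
  intros [H1 H2]. unfold CPS. apply is_pseries_unique in H1, H2. rewrite H1, H2.
  now destruct v.
Qed.

Lemma CPS_correct (a : nat -> C) (y : R) : entire a -> is_CPS a y (CPS a y).
Proof. intros H. destruct (H y) as [v Hv]. now rewrite (is_CPS_unique _ _ _ Hv). Qed.

Lemma is_pseries_ext_R (a b : nat -> R) (y v : R) :
  (forall n, a n = b n) -> is_pseries a y v -> is_pseries b y v.
Proof. exact (is_pseries_ext a b y v). Qed.

Lemma is_CPS_ext (a b : nat -> C) (y : R) (v : C) :
  (forall n, a n = b n) -> is_CPS a y v -> is_CPS b y v.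
Proof.
  intros H [H1 H2]. split;
  [eapply is_pseries_ext_R; [|exact H1] | eapply is_pseries_ext_R; [|exact H2]];
  intros n; simpl; now rewrite H.
Qed.

Lemma is_pseries_lincomb (a b : nat -> R) (y u v p q : R) :
  is_pseries a y u -> is_pseries b y v ->
  is_pseries (fun n => p * a n + q * b n) y (p * u + q * v).
Proof.
  intros Ha Hb.
  apply (is_pseries_plus (fun n => p * a n) (fun n => q * b n) y (p * u) (q * v));
  [apply (is_pseries_scal p a y u) | apply (is_pseries_scal q b y v)];
  first [assumption | apply Rmult_comm].
Qed.

Lemma is_CPS_scal (c : C) (a : nat -> C) (y : R) (v : C) :
  is_CPS a y v -> is_CPS (fun n => c * a n)%C y (c * v)%C.
Proof.
  intros [H1 H2]. split.
  - rewrite Re_mult. replace (Re c * Re v - Im c * Im v) with (Re c * Re v + (- Im c) * Im v) by ring.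
    eapply is_pseries_ext_R; [|apply (is_pseries_lincomb _ _ _ _ _ (Re c) (- Im c) H1 H2)].
    intros n. cbv beta. rewrite Re_mult. ring.
  - rewrite Im_mult.
    eapply is_pseries_ext_R; [|apply (is_pseries_lincomb _ _ _ _ _ (Re c) (Im c) H2 H1)].
    intros n. cbv beta. rewrite Im_mult. ring.
Qed.

Lemma is_CPS_odd_even (a : nat -> C) (y : R) (u v : C) :
  is_CPS (fun n => a (2 * n)%nat) (y ^ 2) u ->
  is_CPS (fun n => a (2 * n + 1)%nat) (y ^ 2) v ->
  is_CPS a y (u + RtoC y * v)%C.
Proof.
  intros [H1 H2] [H3 H4]. split.
  - rewrite Re_plus, re_scal_l. now apply (is_pseries_odd_even (fun n => Re (a n))).
  - rewrite Im_plus, im_scal_l. now apply (is_pseries_odd_even (fun n => Im (a n))).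
Qed.

Lemma is_CPS_0 (y : R) : is_CPS (fun _ => RtoC 0) y (RtoC 0).
Proof.
  assert (H : is_pseries (fun _ : nat => 0) y 0).
  { apply (is_series_ext (fun _ => 0)).
    - intros n. unfold scal; simpl; unfold mult; simpl. ring.
    - change (is_lim_seq (sum_n (fun _ : nat => 0)) 0).
      apply (is_lim_seq_ext (fun _ => 0)); [|apply is_lim_seq_const].
      intros n. rewrite sum_n_const. ring. }
  split; exact H.
Qed.

Lemma is_CPS_incr_1 (a : nat -> C) (y : R) (v : C) :
  is_CPS a y v ->
  is_CPS (fun n => match n with O => RtoC 0 | S m => a m end) y (RtoC y * v)%C.
Proof.
  intros [H1 H2]. split.
  - rewrite re_scal_l.
    eapply is_pseries_ext_R; [|exact (is_pseries_incr_1 (fun n => Re (a n)) y _ H1)].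
    now intros [|n].
  - rewrite im_scal_l.
    eapply is_pseries_ext_R; [|exact (is_pseries_incr_1 (fun n => Im (a n)) y _ H2)].
    now intros [|n].
Qed.

Lemma is_CPS_incr_n (a : nat -> C) (l : nat) (y : R) (v : C) :
  (forall n, (n < l)%nat -> a n = RtoC 0) ->
  is_CPS (fun n => a (n + l)%nat) y v -> is_CPS a y (RtoC (y ^ l) * v)%C.
Proof.
  revert a. induction l; intros a H0 H.
  - simpl. rewrite Cmult_1_l. apply is_CPS_ext with (2 := H). intros n. f_equal; lia.
  - assert (H' : is_CPS (fun n => a (S n)) y (RtoC (y ^ l) * v)%C).
    { apply IHl.
      - intros n Hn. apply H0. lia.
      - apply is_CPS_ext with (2 := H). intros n. f_equal; lia. }
    apply is_CPS_incr_1 in H'. simpl pow. rewrite RtoC_mult, <- Cmult_assoc.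
    apply is_CPS_ext with (2 := H'). intros [|n]; [|reflexivity]. symmetry; apply H0; lia.
Qed.


(** * Finite complex sums and polynomials as power series *)

Lemma Csum_O (u : nat -> C) : sum_n u 0 = u O :> C.
Proof. apply sum_O. Qed.

Lemma Csum_S (u : nat -> C) (n : nat) : sum_n u (S n) = (sum_n u n + u (S n))%C :> C.
Proof. exact (sum_Sn u n). Qed.

Lemma Csum_S_l (u : nat -> C) (n : nat) :
  sum_n u (S n) = (u O + sum_n (fun k => u (S k)) n)%C :> C.
Proof.
  induction n.
  - now rewrite Csum_S, !Csum_O.
  - rewrite Csum_S, IHn, (Csum_S (fun k => u (S k))). now rewrite Cplus_assoc.
Qed.

Lemma Csum_ext (u v : nat -> C) (n : nat) :
  (forall k, (k <= n)%nat -> u k = v k) -> sum_n u n = sum_n v n :> C.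
Proof. apply sum_n_ext_loc. Qed.

Lemma Csum_plus (u v : nat -> C) (n : nat) :
  sum_n (fun k => u k + v k)%C n = (sum_n u n + sum_n v n)%C :> C.
Proof. exact (sum_n_plus u v n). Qed.

Lemma Csum_mult_l (c : C) (u : nat -> C) (n : nat) :
  sum_n (fun k => c * u k)%C n = (c * sum_n u n)%C :> C.
Proof.
  induction n.
  - now rewrite !Csum_O.
  - rewrite !Csum_S, IHn. ring.
Qed.

Lemma Re_Csum (u : nat -> C) (n : nat) : Re (sum_n u n) = sum_n (fun k => Re (u k)) n.
Proof.
  induction n; [now rewrite Csum_O, sum_O|].
  rewrite Csum_S, Re_plus, IHn, sum_Sn. reflexivity.
Qed.

Lemma Im_Csum (u : nat -> C) (n : nat) : Im (sum_n u n) = sum_n (fun k => Im (u k)) n.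
Proof.
  induction n; [now rewrite Csum_O, sum_O|].
  rewrite Csum_S, Im_plus, IHn, sum_Sn. reflexivity.
Qed.

Lemma is_pseries_decr (a : nat -> R) (y v : R) :
  is_pseries (fun n => a (S n)) y v -> is_pseries a y (a O + y * v).
Proof.
  intros H. apply is_pseries_R. apply is_pseries_R in H.
  apply (@is_series_decr_1 R_AbsRing R_NormedModule).
  change (is_series (fun n => a (S n) * y ^ S n) (a O + y * v + - (a O * y ^ 0))).
  replace (a O + y * v + - (a O * y ^ 0)) with (y * v) by (simpl; ring).
  apply (is_series_ext (fun n => y * (a (S n) * y ^ n))).
  - intros n. change (y * (a (S n) * y ^ n) = a (S n) * y ^ S n). simpl. ring.
  - now apply (is_series_scal y (fun n => a (S n) * y ^ n)).
Qed.

Lemma is_CPS_decr (a : nat -> C) (y : R) (v : C) :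
  is_CPS (fun n => a (S n)) y v -> is_CPS a y (a O + RtoC y * v)%C.
Proof.
  intros [H1 H2]. split.
  - rewrite Re_plus, re_scal_l. now apply (is_pseries_decr (fun n => Re (a n))).
  - rewrite Im_plus, im_scal_l. now apply (is_pseries_decr (fun n => Im (a n))).
Qed.

Lemma is_CPS_finite (a : nat -> C) (l : nat) (y : R) :
  (forall n, (l < n)%nat -> a n = RtoC 0) ->
  is_CPS a y (sum_n (fun k => a k * RtoC (y ^ k))%C l).
Proof.
  revert a. induction l; intros a H0.
  - rewrite Csum_O. simpl.
    replace (a O * RtoC 1)%C with (a O + RtoC y * RtoC 0)%C by ring.
    apply is_CPS_decr, (is_CPS_ext (fun _ => RtoC 0)); [|apply is_CPS_0].
    intros n. symmetry; apply H0; lia.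
  - rewrite Csum_S_l.
    replace (a O * RtoC (y ^ 0) + sum_n (fun k => a (S k) * RtoC (y ^ S k)) l)%C
      with (a O + RtoC y * sum_n (fun k => a (S k) * RtoC (y ^ k)) l)%C.
    + apply is_CPS_decr, (IHl (fun n => a (S n))). intros n Hn. apply H0; lia.
    + rewrite <- Csum_mult_l. f_equal; [simpl; ring|].
      apply Csum_ext. intros k _. simpl. rewrite RtoC_mult. ring.
Qed.

(** * Infinite radius of convergence, Cauchy products and the exponential series *)

Lemma CV_radius_infinite (a : nat -> R) :
  (forall y, ex_pseries a y) -> CV_radius a = p_infty.
Proof.
  intros H. destruct (CV_radius a) as [r| |] eqn:E; [exfalso | reflexivity | exfalso].
  - apply (CV_disk_outside a (Rabs r + 1)).
    + rewrite E. simpl. pose proof (Rabs_pos r). pose proof (Rle_abs r).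
      rewrite (Rabs_pos_eq (Rabs r + 1)); lra.
    + apply ex_series_lim_0. destruct (H (Rabs r + 1)) as [v Hv]. exists v.
      now apply is_pseries_R.
  - pose proof (CV_radius_ge_0 a) as P. rewrite E in P. exact P.
Qed.

Lemma entire_CV_radius (a : nat -> C) : entire a ->
  CV_radius (fun n => Re (a n)) = p_infty /\ CV_radius (fun n => Im (a n)) = p_infty.
Proof.
  intros H. split; apply CV_radius_infinite; intros y; destruct (H y) as [v [H1 H2]]; eexists; eassumption.
Qed.

Definition conv (a b : nat -> C) (n : nat) : C := sum_n (fun k => a k * b (n - k)%nat)%C n.

Lemma is_CPS_conv (a b : nat -> C) (y : R) (u v : C) :
  entire a -> entire b -> is_CPS a y u -> is_CPS b y v -> is_CPS (conv a b) y (u * v)%C.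
Proof.
  intros Ea Eb [A1 A2] [B1 B2].
  destruct (entire_CV_radius a Ea) as [Ra1 Ra2]. destruct (entire_CV_radius b Eb) as [Rb1 Rb2].
  assert (L : forall f g p q, is_pseries f y p -> is_pseries g y q ->
    CV_radius f = p_infty -> CV_radius g = p_infty -> is_pseries (PS_mult f g) y (p * q)).
  { intros f g p q Hf Hg Rf Rg. apply is_pseries_mult; try assumption; now rewrite ?Rf, ?Rg. }
  assert (M : forall f g n, PS_mult f g n = sum_n (fun k => f k * g (n - k)%nat) n).
  { intros f g n. unfold PS_mult. now rewrite sum_n_Reals. }
  split.
  - rewrite Re_mult. replace (Re u * Re v - Im u * Im v) with
      (1 * (Re u * Re v) + (-1) * (Im u * Im v)) by ring.
    eapply is_pseries_ext_R;
      [|exact (is_pseries_lincomb _ _ _ _ _ 1 (-1) (L _ _ _ _ A1 B1 Ra1 Rb1) (L _ _ _ _ A2 B2 Ra2 Rb2))].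
    intros n. cbv beta. unfold conv. rewrite Re_Csum, !M, !sum_n_Reals, !scal_sum, <- sum_plus.
    apply sum_eq. intros k _. rewrite Re_mult. ring.
  - rewrite Im_mult. replace (Re u * Im v + Im u * Re v) with
      (1 * (Re u * Im v) + 1 * (Im u * Re v)) by ring.
    eapply is_pseries_ext_R;
      [|exact (is_pseries_lincomb _ _ _ _ _ 1 1 (L _ _ _ _ A1 B2 Ra1 Rb2) (L _ _ _ _ A2 B1 Ra2 Rb1))].
    intros n. cbv beta. unfold conv. rewrite Im_Csum, !M, !sum_n_Reals, !scal_sum, <- sum_plus.
    apply sum_eq. intros k _. rewrite Im_mult. ring.
Qed.

Lemma entire_conv (a b : nat -> C) : entire a -> entire b -> entire (conv a b).
Proof.
  intros Ea Eb y. exists (CPS a y * CPS b y)%C.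
  apply is_CPS_conv; try assumption; now apply CPS_correct.
Qed.

Definition expc (c : R) (n : nat) : C := RtoC (c ^ n / INR (Factorial.fact n)).

Lemma is_CPS_expc (c y : R) : is_CPS (expc c) y (RtoC (exp (c * y))).
Proof.
  split.
  - rewrite re_RtoC. apply is_pseries_R. pose proof (is_exp_Reals (c * y)) as H.
    apply is_pseries_R in H. eapply is_series_ext; [|exact H].
    intros n. simpl. rewrite Rpow_mult_distr. unfold Rdiv.
    change (/ INR (Factorial.fact n) * (c ^ n * y ^ n) = c ^ n * / INR (Factorial.fact n) * y ^ n). ring.
  - rewrite im_RtoC. apply (is_pseries_ext_R (fun _ => 0)); [reflexivity|].
    apply (proj1 (is_CPS_0 y)).
Qed.

Lemma entire_expc (c : R) : entire (expc c).
Proof. intros y. eexists. apply is_CPS_expc. Qed.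

Lemma entire_bound (a : nat -> C) (K B : R) : 0 <= B ->
  (forall n, Cmod (a n) <= K * (B ^ n / INR (Factorial.fact n))) -> entire a.
Proof.
  intros HB H y.
  assert (S : ex_series (fun n => K * (B ^ n / INR (Factorial.fact n) * Rabs y ^ n))).
  { apply (ex_series_scal K (fun n => B ^ n / INR (Factorial.fact n) * Rabs y ^ n)).
    exists (exp (B * Rabs y)). apply is_pseries_R. exact (proj1 (is_CPS_expc B (Rabs y))). }
  assert (L : forall f : nat -> R, (forall n, Rabs (f n) <= Cmod (a n)) -> ex_pseries f y).
  { intros f Hf.
    assert (Q : ex_series (fun n => f n * y ^ n)).
    { apply (ex_series_le (fun n => f n * y ^ n)) with (2 := S). intros n.
      change (Rabs (f n * y ^ n) <= K * (B ^ n / INR (Factorial.fact n) * Rabs y ^ n)).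
      rewrite Rabs_mult, RPow_abs, <- Rmult_assoc. apply Rmult_le_compat_r; [apply Rabs_pos|].
      apply Rle_trans with (1 := Hf n), H. }
    destruct Q as [v Hv]. exists v. now apply is_pseries_R. }
  destruct (L (fun n => Re (a n))) as [v1 H1]; [intros n; apply re_le_Cmod|].
  destruct (L (fun n => Im (a n))) as [v2 H2]; [intros n; apply Im_le_Cmod|].
  exists (v1, v2). now split.
Qed.

(** * Formal power series: Euler operator and shift *)

Definition theta (a : nat -> C) (n : nat) : C := (RtoC (INR n) * a n)%C.
Definition shift (a : nat -> C) (n : nat) : C := match n with O => RtoC 0 | S m => a m end.

Lemma conv_ext (a b a' b' : nat -> C) (n : nat) :
  (forall k, a k = a' k) -> (forall k, b k = b' k) -> conv a b n = conv a' b' n.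
Proof. intros H1 H2. apply Csum_ext. intros k _. now rewrite H1, H2. Qed.

Lemma conv_scal_l (c : C) (a b : nat -> C) (n : nat) :
  conv (fun k => c * a k)%C b n = (c * conv a b n)%C.
Proof. unfold conv. rewrite <- Csum_mult_l. apply Csum_ext. intros k _. ring. Qed.

Lemma conv_lincomb_r (p q : C) (a b b' : nat -> C) (n : nat) :
  conv a (fun k => p * b k + q * b' k)%C n = (p * conv a b n + q * conv a b' n)%C.
Proof.
  unfold conv. rewrite <- !Csum_mult_l, <- Csum_plus. apply Csum_ext. intros k _. ring.
Qed.

Lemma conv_shift_l (a b : nat -> C) (n : nat) : conv (shift a) b n = shift (conv a b) n.
Proof.
  destruct n; unfold conv.
  - rewrite Csum_O. simpl. ring.
  - rewrite Csum_S_l. simpl shift. rewrite Cmult_0_l, Cplus_0_l. reflexivity.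
Qed.

Lemma conv_shift_r (a b : nat -> C) (n : nat) : conv a (shift b) n = shift (conv a b) n.
Proof.
  destruct n; unfold conv.
  - rewrite Csum_O. simpl. ring.
  - rewrite Csum_S, Nat.sub_diag. change (shift b 0) with (RtoC 0).
    rewrite Cmult_0_r, Cplus_0_r.
    apply Csum_ext. intros k Hk. now replace (S n - k)%nat with (S (n - k)) by lia.
Qed.

(** Leibniz rule for [theta = y d/dy], from [n = k + (n - k)]. With [shift] as multiplication by
    [y], it allows a factor [exp (c y)] to be moved through differential operators on the level of
    coefficients. *)
Lemma theta_conv (a b : nat -> C) (n : nat) :
  theta (conv a b) n = (conv (theta a) b n + conv a (theta b) n)%C.
Proof.
  unfold theta at 1, conv. rewrite <- Csum_mult_l, <- Csum_plus.
  apply Csum_ext. intros k Hk. unfold theta.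
  replace (INR n) with (INR k + INR (n - k)) by (rewrite <- plus_INR; f_equal; lia).
  rewrite RtoC_plus. ring.
Qed.

Lemma theta_expc (c : R) (n : nat) : theta (expc c) n = (RtoC c * shift (expc c) n)%C.
Proof.
  unfold theta, expc. destruct n; simpl shift.
  - simpl INR. ring.
  - rewrite <- !RtoC_mult. f_equal. rewrite fact_simpl, mult_INR. simpl pow.
    pose proof (INR_fact_neq_0 n). pose proof (not_0_INR (S n) ltac:(lia)). field. split; assumption.
Qed.

(** * Iterated derivatives at 0 of complex-valued functions *)

Definition is_Cderive (f : R -> C) (t : R) (d : C) : Prop :=
  is_derive (fun s => Re (f s)) t (Re d) /\ is_derive (fun s => Im (f s)) t (Im d).

Lemma is_derive_mult_R (f g : R -> R) (t df dg : R) :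
  is_derive f t df -> is_derive g t dg ->
  is_derive (fun s => f s * g s) t (df * g t + f t * dg).
Proof. intros H1 H2. apply (is_derive_mult f g t df dg H1 H2). exact Rmult_comm. Qed.

Lemma is_Cderive_mult (f g : R -> C) (t : R) (df dg : C) :
  is_Cderive f t df -> is_Cderive g t dg ->
  is_Cderive (fun s => f s * g s)%C t (df * g t + f t * dg)%C.
Proof.
  intros [F1 F2] [G1 G2]. split.
  - replace (Re (df * g t + f t * dg)%C) with
      ((Re df * Re (g t) + Re (f t) * Re dg) - (Im df * Im (g t) + Im (f t) * Im dg))
      by (rewrite Re_plus, !Re_mult; ring).
    apply (is_derive_minus (fun s => Re (f s) * Re (g s)) (fun s => Im (f s) * Im (g s)));
      now apply is_derive_mult_R.
  - replace (Im (df * g t + f t * dg)%C) with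
      ((Re df * Im (g t) + Re (f t) * Im dg) + (Im df * Re (g t) + Im (f t) * Re dg))
      by (rewrite Im_plus, !Im_mult; ring).
    apply (is_derive_plus (fun s => Re (f s) * Im (g s)) (fun s => Im (f s) * Re (g s)));
      now apply is_derive_mult_R.
Qed.

Lemma is_Cderive_lincomb (f g : R -> C) (t : R) (p q df dg : C) :
  is_Cderive f t df -> is_Cderive g t dg ->
  is_Cderive (fun s => p * f s + q * g s)%C t (p * df + q * dg)%C.
Proof.
  assert (K : forall c : C, is_Cderive (fun _ => c) t (RtoC 0)).
  { intros c. split; apply (@is_derive_const R_AbsRing R_NormedModule). }
  intros F G.
  pose proof (is_Cderive_mult _ _ _ _ _ (K p) F) as [A1 A2].
  pose proof (is_Cderive_mult _ _ _ _ _ (K q) G) as [B1 B2].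
  replace (p * df + q * dg)%C with ((0 * f t + p * df) + (0 * g t + q * dg))%C by ring.
  split.
  - rewrite Re_plus. exact (is_derive_plus _ _ _ _ _ A1 B1).
  - rewrite Im_plus. exact (is_derive_plus _ _ _ _ _ A2 B2).
Qed.

Lemma is_Cderive_comp (f : R -> C) (g : R -> R) (t dg : R) (d : C) :
  is_Cderive f (g t) d -> is_derive g t dg -> is_Cderive (fun s => f (g s)) t (RtoC dg * d)%C.
Proof.
  intros [F1 F2] G. split.
  - rewrite re_scal_l. exact (is_derive_comp (fun s => Re (f s)) g t _ _ F1 G).
  - rewrite im_scal_l. exact (is_derive_comp (fun s => Im (f s)) g t _ _ F2 G).
Qed.

Lemma is_Cderive_rcpow (w : C) (t : R) : t < 1 ->
  is_Cderive (fun s => rcpow (1 - s) w) t (- w * rcpow (1 - t) (w - 1))%C.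
Proof.
  intros Ht.
  assert (E : rcpow (1 - t) (w - 1)%C = (RtoC (/ (1 - t)) * rcpow (1 - t) w)%C).
  { unfold Cminus. rewrite rcpow_plus, rcpow_opp, rcpow_1, RtoC_inv by lra. ring. }
  rewrite E. destruct w as [p q]. unfold rcpow, cexp, is_Cderive, Re, Im; simpl. split.
  - auto_derive; [lra|]. unfold Rminus. field. lra.
  - auto_derive; [lra|]. unfold Rminus. field. lra.
Qed.

Definition dcoef (a : nat -> C) (n : nat) : C := (RtoC (INR n + 1) * a (S n))%C.

Lemma Rabs_lt_CV_radius (a : nat -> R) (y : R) : CV_radius a = p_infty ->
  Rbar_lt (Rabs y) (CV_radius a).
Proof. now intros ->. Qed.

Lemma is_CPS_dcoef (a : nat -> C) (y : R) : entire a ->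
  is_CPS (dcoef a) y (CPS (dcoef a) y) /\ is_Cderive (CPS a) y (CPS (dcoef a) y).
Proof.
  intros Ea. destruct (entire_CV_radius a Ea) as [R1 R2].
  assert (E1 : forall n, PS_derive (fun k => Re (a k)) n = Re (dcoef a n)).
  { intros n. unfold PS_derive, dcoef. now rewrite re_scal_l, S_INR. }
  assert (E2 : forall n, PS_derive (fun k => Im (a k)) n = Im (dcoef a n)).
  { intros n. unfold PS_derive, dcoef. now rewrite im_scal_l, S_INR. }
  split; split.
  - apply (is_pseries_ext_R _ _ _ _ E1).
    change (Re (CPS (dcoef a) y)) with (PSeries (fun n => Re (dcoef a n)) y).
    rewrite <- (PSeries_ext _ _ y E1). apply PSeries_correct, ex_pseries_derive.
    now apply Rabs_lt_CV_radius.
  - apply (is_pseries_ext_R _ _ _ _ E2).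
    change (Im (CPS (dcoef a) y)) with (PSeries (fun n => Im (dcoef a n)) y).
    rewrite <- (PSeries_ext _ _ y E2). apply PSeries_correct, ex_pseries_derive.
    now apply Rabs_lt_CV_radius.
  - change (Re (CPS (dcoef a) y)) with (PSeries (fun n => Re (dcoef a n)) y).
    rewrite <- (PSeries_ext _ _ y E1).
    apply is_derive_PSeries. now apply Rabs_lt_CV_radius.
  - change (Im (CPS (dcoef a) y)) with (PSeries (fun n => Im (dcoef a n)) y).
    rewrite <- (PSeries_ext _ _ y E2).
    apply is_derive_PSeries. now apply Rabs_lt_CV_radius.
Qed.

Lemma entire_dcoef (a : nat -> C) : entire a -> entire (dcoef a).
Proof. intros Ea y. eexists. now apply is_CPS_dcoef. Qed.

(* A relation rather than [Derive_n], so that sums need no separate differentiability side conditions. *)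
Fixpoint has_derivative0 (j : nat) (f : R -> C) (v : C) : Prop :=
  match j with
  | O => f 0 = v
  | S i => exists f', locally 0 (fun t => is_Cderive f t (f' t)) /\ has_derivative0 i f' v
  end.

Lemma has_derivative0_Cderive_n (j : nat) (f : R -> C) (v : C) :
  has_derivative0 j f v -> Cderive_n f j 0 = v.
Proof.
  revert f. induction j; intros f H.
  - simpl in H. rewrite <- H. unfold Cderive_n. simpl. now destruct (f 0).
  - destruct H as [f' [Hd H]]. rewrite <- (IHj f' H). unfold Cderive_n.
    f_equal.
    + rewrite <- Nat.add_1_r, <- (Derive_n_comp _ j 1). apply Derive_n_ext_loc.
      apply filter_imp with (2 := Hd). intros t [D _]. now apply is_derive_unique.
    + rewrite <- Nat.add_1_r, <- (Derive_n_comp _ j 1). apply Derive_n_ext_loc.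
      apply filter_imp with (2 := Hd). intros t [_ D]. now apply is_derive_unique.
Qed.

Lemma has_derivative0_ext_loc (j : nat) (f g : R -> C) (v : C) :
  locally 0 (fun t => f t = g t) -> has_derivative0 j f v -> has_derivative0 j g v.
Proof.
  intros E H. destruct j.
  - simpl in *. rewrite <- H. symmetry. exact (locally_singleton _ _ E).
  - destruct H as [f' [Hd H]]. exists f'. split; [|exact H].
    apply locally_locally in E.
    apply filter_imp with (2 := filter_and _ _ E Hd). intros t [Et [D1 D2]]. split.
    + apply is_derive_ext_loc with (2 := D1). apply filter_imp with (2 := Et). now intros s ->.
    + apply is_derive_ext_loc with (2 := D2). apply filter_imp with (2 := Et). now intros s ->.
Qed.

Lemma has_derivative0_lincomb (j : nat) (f g : R -> C) (p q u v : C) :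
  has_derivative0 j f u -> has_derivative0 j g v ->
  has_derivative0 j (fun t => p * f t + q * g t)%C (p * u + q * v)%C.
Proof.
  revert f g. induction j; intros f g F G.
  - simpl in *. now rewrite F, G.
  - destruct F as [f' [F F']], G as [g' [G G']].
    exists (fun t => p * f' t + q * g' t)%C. split; [|now apply IHj].
    apply filter_imp with (2 := filter_and _ _ F G). intros t [D1 D2].
    now apply is_Cderive_lincomb.
Qed.

Lemma has_derivative0_sum (j l : nat) (f : nat -> R -> C) (c v : nat -> C) :
  (forall k, has_derivative0 j (f k) (v k)) ->
  has_derivative0 j (fun t => sum_n (fun k => c k * f k t)%C l) (sum_n (fun k => c k * v k)%C l).
Proof.
  intros H. induction l.
  - rewrite Csum_O. apply has_derivative0_ext_loc with (fun t => c O * f O t + 0 * f O t)%C.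
    + apply filter_forall. intros t. rewrite Csum_O. ring.
    + replace (c O * v O)%C with (c O * v O + 0 * v O)%C by ring.
      now apply has_derivative0_lincomb.
  - rewrite Csum_S.
    apply has_derivative0_ext_loc with
      (fun t => 1 * sum_n (fun k => c k * f k t)%C l + c (S l) * f (S l) t)%C.
    + apply filter_forall. intros t. rewrite Csum_S, Cmult_1_l. reflexivity.
    + rewrite <- (Cmult_1_l (sum_n _ l)). now apply has_derivative0_lincomb.
Qed.

(** * Functions [(1 - t)^-b f (x t / (1 - t))] and their derivatives at 0 *)

Definition pullback (b : C) (a : nat -> C) (x t : R) : C :=
  (rcpow (1 - t) (- b) * CPS a (x * t / (1 - t)))%C.

(** [j!] times the coefficient of [t^j], obtained by expanding each [t^m (1 - t)^-(b + m)] with the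
    binomial series. *)
Definition pullback_deriv (j : nat) (b : C) (a : nat -> C) (x : R) : C :=
  sum_n (fun m => RtoC (INR (Factorial.fact j)) *
    (a m * RtoC (x ^ m) * poch (b + RtoC (INR m)) (j - m))
    / RtoC (INR (Factorial.fact (j - m))))%C j.

(** The power contributes the parameter [b + 1]; the inner function has derivative [x (1 - t)^-2],
    so the series contributes [b + 2]. The family is thus closed under [d/dt], and induction on the
    order can run over all [b] and [a] at once. *)
Lemma is_Cderive_pullback (b : C) (a : nat -> C) (x t : R) : entire a -> t < 1 ->
  is_Cderive (pullback b a x) t
    (b * pullback (b + 1) a x t + RtoC x * pullback (b + 2) (dcoef a) x t)%C.
Proof.
  intros Ea Ht.
  assert (Hs : is_derive (fun s => x * s / (1 - s)) t (x / (1 - t) ^ 2)).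
  { auto_derive; [lra|]. field. lra. }
  pose proof (is_Cderive_comp (CPS a) _ t _ _ (proj2 (is_CPS_dcoef a _ Ea)) Hs) as D2.
  pose proof (is_Cderive_rcpow (- b) t Ht) as D1.
  pose proof (is_Cderive_mult _ _ _ _ _ D1 D2) as D.
  match type of D with is_Cderive _ _ ?d => match goal with |- is_Cderive _ _ ?v =>
    replace v with d; [exact D|] end end.
  unfold pullback.
  replace (- b - 1)%C with (- b + - (1))%C by ring.
  replace (- (b + 1))%C with (- b + - (1))%C by ring.
  replace (- (b + 2))%C with (- b + (- (1) + - (1)))%C by ring.
  rewrite !rcpow_plus, !rcpow_opp, rcpow_1 by lra.
  replace (RtoC (x / (1 - t) ^ 2)) with (RtoC x * (/ RtoC (1 - t) * / RtoC (1 - t)))%C; [ring|].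
  rewrite <- !RtoC_inv, <- !RtoC_mult by lra. f_equal. field. lra.
Qed.

Lemma pullback_deriv_S (j : nat) (b : C) (a : nat -> C) (x : R) :
  pullback_deriv (S j) b a x =
  (b * pullback_deriv j (b + 1) a x + RtoC x * pullback_deriv j (b + 2) (dcoef a) x)%C.
Proof.
  unfold pullback_deriv. rewrite <- !Csum_mult_l.
  (* [V] is the second sum reindexed by one and vanishes at 0. With [d = j - m], equality of the
     terms then amounts to [b (d + 1) + m (b + m + d + 1) = (b + m) (m + d + 1)]. *)
  set (V := fun m => (RtoC (INR (Factorial.fact j)) * RtoC (INR m) *
    (a m * RtoC (x ^ m) * poch (b + RtoC (INR m) + 1) (S j - m))
    / RtoC (INR (Factorial.fact (S j - m))))%C).
  rewrite (Csum_ext (fun k => RtoC x * _)%C (fun m => V (S m))).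
  2:{ intros m Hm. unfold V, dcoef. rewrite S_INR. simpl pow. rewrite RtoC_mult, Nat.sub_succ.
      replace (b + RtoC (INR m + 1) + 1)%C with (b + 2 + RtoC (INR m))%C
        by (rewrite RtoC_plus; ring). unfold Cdiv. ring. }
  assert (EV : sum_n (fun m => V (S m)) j = (sum_n V j + V (S j))%C :> C).
  { rewrite <- Csum_S, Csum_S_l. replace (V O) with (RtoC 0); [now rewrite Cplus_0_l|].
    unfold V. simpl INR. unfold Cdiv. ring. }
  rewrite EV, Csum_S, Cplus_assoc, <- Csum_plus. f_equal.
  - apply Csum_ext. intros m Hm. unfold V.
    replace (S j - m)%nat with (S (j - m)) by lia.
    rewrite !fact_S_C. rewrite (poch_S_l (b + RtoC (INR m))), poch_S.
    replace (b + 1 + RtoC (INR m))%C with (b + RtoC (INR m) + 1)%C by ring.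
    set (d := (j - m)%nat). replace (INR j) with (INR m + INR d)
      by (unfold d; rewrite <- plus_INR; f_equal; lia).
    pose proof (fact_neq0_C d). pose proof (INR_S_neq0_C d) as Hd.
    rewrite !RtoC_plus in *. field. split; assumption.
  - unfold V. rewrite Nat.sub_diag, !poch_0, fact_S_C, S_INR. unfold Cdiv. ring.
Qed.

Lemma has_derivative0_pullback (j : nat) (b : C) (a : nat -> C) (x : R) : entire a ->
  has_derivative0 j (pullback b a x) (pullback_deriv j b a x).
Proof.
  revert b a. induction j; intros b a Ea.
  - simpl. unfold pullback, pullback_deriv. rewrite Csum_O. simpl.
    replace (x * 0 / (1 - 0)) with 0 by field. unfold CPS. rewrite !PSeries_0.
    rewrite Rminus_0_r. unfold rcpow. rewrite ln_1, Cmult_0_r, cexp_RtoC, exp_0.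
    replace (Re (a 0%nat), Im (a 0%nat)) with (a 0%nat) by now destruct (a O).
    field.
  - rewrite pullback_deriv_S.
    exists (fun t => b * pullback (b + 1) a x t + RtoC x * pullback (b + 2) (dcoef a) x t)%C.
    split.
    + exists (mkposreal 1 Rlt_0_1). intros t Ht.
      apply is_Cderive_pullback; [exact Ea|].
      unfold ball in Ht; simpl in Ht; unfold AbsRing_ball, abs, minus, plus, opp in Ht; simpl in Ht.
      apply Rabs_def2 in Ht. lra.
    + apply has_derivative0_lincomb; apply IHj; [exact Ea | now apply entire_dcoef].
Qed.

(** * The modified Bessel functions *)

(** Once [|z + k| >= 1], the functional equation makes the modulus nonincreasing in [k]; finitely
    many values remain. *)
Lemma rgamma_bounded (z : C) : exists K, forall k : nat, Cmod (rgamma (z + RtoC (INR k))) <= K.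
Proof.
  destruct (INR_unbounded (Cmod z + 1)) as [N HN].
  assert (H1 : forall k, (N <= k)%nat ->
    Cmod (rgamma (z + RtoC (INR k))) <= Cmod (rgamma (z + RtoC (INR N)))).
  { intros k Hk. induction Hk as [|k Hk IH]; [lra|].
    apply Rle_trans with (2 := IH).
    rewrite (rgamma_S (z + RtoC (INR k))), Cmod_mult, S_INR, RtoC_plus, <- Cplus_assoc.
    assert (1 <= Cmod (z + RtoC (INR k))).
    { pose proof (Cmod_triangle (z + RtoC (INR k)) (- z))%C as T.
      replace (z + RtoC (INR k) + - z)%C with (RtoC (INR k)) in T by ring.
      rewrite Cmod_opp, Cmod_R, Rabs_pos_eq in T by apply pos_INR.
      apply le_INR in Hk. lra. }
    pose proof (Cmod_ge_0 (rgamma (z + (RtoC (INR k) + 1)))). nra. }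
  assert (H2 : forall n, exists K, forall k, (k < n)%nat -> Cmod (rgamma (z + RtoC (INR k))) <= K).
  { induction n as [|n [K HK]]; [exists 0; lia|].
    exists (Rmax K (Cmod (rgamma (z + RtoC (INR n))))). intros k Hk.
    destruct (Nat.eq_dec k n) as [->|Hne]; [apply Rmax_r|].
    apply Rle_trans with (2 := Rmax_l _ _). apply HK. lia. }
  destruct (H2 N) as [K HK]. exists (Rmax K (Cmod (rgamma (z + RtoC (INR N))))).
  intros k. destruct (Nat.lt_ge_cases k N) as [Hk|Hk].
  - apply Rle_trans with (2 := Rmax_l _ _). now apply HK.
  - apply Rle_trans with (2 := Rmax_r _ _). now apply H1.
Qed.

Definition Icoef (nu : C) (k : nat) : C :=
  (rgamma (RtoC (INR k) + nu + 1) / RtoC (INR (Factorial.fact k)))%C.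

Lemma entire_Icoef (nu : C) : entire (Icoef nu).
Proof.
  destruct (rgamma_bounded (nu + 1)) as [K HK].
  apply (entire_bound _ K 1); [lra|]. intros k. unfold Icoef.
  rewrite Cmod_div, Cmod_R, Rabs_pos_eq by (apply fact_neq0_C || apply pos_INR).
  replace (RtoC (INR k) + nu + 1)%C with (nu + 1 + RtoC (INR k))%C by ring.
  rewrite pow1. unfold Rdiv. rewrite Rmult_1_l. apply Rmult_le_compat_r; [|apply HK].
  left. apply Rinv_0_lt_compat, INR_fact_lt_0.
Qed.

Lemma Itilde_CPS (nu : C) (y : R) : Itilde nu (RtoC (2 * y)) = CPS (Icoef nu) (y ^ 2).
Proof.
  unfold Itilde, CSeries, CPS, PSeries.
  assert (E : forall k, (Cpow (RtoC (2 * y) / 2) (2 * k) / RtoC (INR (Factorial.fact k))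
     * rgamma (RtoC (INR k) + nu + 1))%C = (Icoef nu k * RtoC ((y ^ 2) ^ k))%C).
  { intros k. unfold Icoef. rewrite <- pow_mult.
    replace (RtoC (2 * y) / 2)%C with (RtoC y).
    - rewrite RtoC_pow. unfold Cdiv. ring.
    - rewrite RtoC_mult. field. }
  f_equal; apply Series_ext; intros k; rewrite E.
  - apply re_scal_r.
  - apply im_scal_r.
Qed.

Lemma is_CPS_dilate (a : nat -> C) (c y : R) (v : C) :
  is_CPS a (c * y) v -> is_CPS (fun n => a n * RtoC (c ^ n))%C y v.
Proof.
  intros [H1 H2]. split; apply is_pseries_R; apply is_pseries_R in H1, H2;
  [eapply is_series_ext; [|exact H1] | eapply is_series_ext; [|exact H2]]; intros n;
  rewrite ?re_scal_r, ?im_scal_r, Rpow_mult_distr; symmetry; apply Rmult_assoc.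
Qed.

(** * Half-integer order: [K] is elementary *)

(** Taylor coefficients of [(2 / sqrt PI) y^nu K_nu (2y)] for [nu = l + 1/2]. The recursion is
    [K_(nu+1) (z) = (nu / z) K_nu (z) - K_nu' (z)], which for these functions becomes the operator
    [(2l + 1 - theta) / 2]. *)
Fixpoint Kseries (l n : nat) : C :=
  match l with
  | O => expc (-2) n
  | S m => (RtoC ((2 * INR m + 1 - INR n) / 2) * Kseries m n)%C
  end.

(** The polynomial that remains when [exp (-2y)] is split off from [Kseries]: behind this factor
    [theta] acts as [theta - 2y], which produces the [shift]. *)
Fixpoint Kpoly (l k : nat) : C :=
  match l with
  | O => match k with O => RtoC 1 | S _ => RtoC 0 end
  | S m => (RtoC ((2 * INR m + 1 - INR k) / 2) * Kpoly m k + shift (Kpoly m) k)%C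
  end.

Lemma Kseries_S (l n : nat) :
  Kseries (S l) n = (RtoC ((2 * INR l + 1 - INR n) / 2) * Kseries l n)%C.
Proof. reflexivity. Qed.

Lemma Kpoly_0 (l k : nat) : (l < k)%nat -> Kpoly l k = RtoC 0.
Proof.
  revert k. induction l; intros k Hk; (destruct k as [|k]; [lia|]); simpl; [reflexivity|].
  rewrite !IHl by lia. ring.
Qed.

Lemma Kpoly_top (l : nat) : Kpoly l l = RtoC 1.
Proof.
  induction l; [reflexivity|]. simpl. rewrite IHl, Kpoly_0 by lia. ring.
Qed.

Lemma Kpoly_const (l : nat) : Kpoly l 0 = poch (RtoC (/ 2)) l.
Proof.
  induction l; [reflexivity|]. rewrite poch_S, <- IHl. simpl. rewrite <- RtoC_plus.
  replace ((2 * INR l + 1 - 0) / 2) with (/ 2 + INR l) by field. ring.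
Qed.

Lemma conv_delta (a : nat -> C) (n : nat) : conv a (Kpoly 0) n = a n.
Proof.
  unfold conv. destruct n.
  - rewrite Csum_O. simpl. ring.
  - rewrite Csum_S, Nat.sub_diag.
    rewrite (Csum_ext _ (fun k => 0 * a k)%C), Csum_mult_l.
    + simpl. ring.
    + intros k Hk. replace (S n - k)%nat with (S (n - k)) by lia. simpl. ring.
Qed.

Lemma Kseries_conv (l n : nat) : Kseries l n = conv (expc (-2)) (Kpoly l) n.
Proof.
  revert n. induction l; intros n; [symmetry; apply conv_delta|].
  rewrite Kseries_S. rewrite IHl.
  rewrite (conv_ext (expc (-2)) (Kpoly (S l)) (expc (-2))
    (fun k => 1 * (RtoC (INR l + / 2) * Kpoly l k + RtoC (- / 2) * theta (Kpoly l) k)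
              + 1 * shift (Kpoly l) k)%C).
  2: reflexivity.
  2:{ intros k. unfold theta. simpl.
      replace ((2 * INR l + 1 - INR k) / 2) with (INR l + / 2 + - / 2 * INR k) by field.
      rewrite RtoC_plus, (RtoC_mult (- / 2)). ring. }
  rewrite conv_lincomb_r, conv_lincomb_r, conv_shift_r.
  pose proof (theta_conv (expc (-2)) (Kpoly l) n) as T.
  rewrite (conv_ext (theta (expc (-2))) (Kpoly l) (fun k => RtoC (-2) * shift (expc (-2)) k)%C (Kpoly l))
    in T by (reflexivity || apply theta_expc).
  rewrite conv_scal_l, conv_shift_l in T. unfold theta at 1 in T.
  replace (conv (expc (-2)) (theta (Kpoly l)) n) with
    (RtoC (INR n) * conv (expc (-2)) (Kpoly l) n
     - RtoC (-2) * shift (conv (expc (-2)) (Kpoly l)) n)%C by (rewrite T; ring).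
  replace ((2 * INR l + 1 - INR n) / 2) with (INR l + / 2 + - / 2 * INR n) by field.
  replace (RtoC (-2)) with (- (2))%C by (now rewrite <- RtoC_opp).
  rewrite !RtoC_plus, RtoC_mult, RtoC_opp, RtoC_inv by lra. field.
Qed.

Lemma poch_half (k : nat) : poch (RtoC (/ 2)) k =
  RtoC (INR (Factorial.fact (2 * k)) / (4 ^ k * INR (Factorial.fact k))).
Proof.
  induction k.
  - rewrite poch_0. simpl. f_equal. field.
  - rewrite poch_S, IHk, <- RtoC_plus, <- RtoC_mult. f_equal.
    replace (2 * S k)%nat with (S (S (2 * k))) by lia.
    rewrite !fact_simpl, !mult_INR, !S_INR, mult_INR, INR_2. simpl pow.
    pose proof (INR_fact_neq_0 k). pose proof (pow_nonzero 4 k ltac:(lra)). pose proof (pos_INR k).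
    field. repeat split; lra.
Qed.

Lemma sqrt_PI_neq0 : sqrt PI <> 0.
Proof. apply Rgt_not_eq, sqrt_lt_R0, PI_RGT_0. Qed.

Lemma rgamma_half_nat (k : nat) : rgamma (RtoC (/ 2) + RtoC (INR k)) =
  RtoC (4 ^ k * INR (Factorial.fact k) / INR (Factorial.fact (2 * k)) / sqrt PI).
Proof.
  pose proof (rgamma_poch (RtoC (/ 2)) k) as H. rewrite rgamma_half, poch_half in H.
  pose proof (INR_fact_neq_0 k) as F1. pose proof (INR_fact_neq_0 (2 * k)) as F2.
  pose proof (pow_nonzero 4 k ltac:(lra)) as F3. pose proof sqrt_PI_neq0 as F4.
  set (p := INR (Factorial.fact (2 * k)) / (4 ^ k * INR (Factorial.fact k))) in *.
  assert (P : p <> 0).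
  { unfold p, Rdiv. apply Rmult_integral_contrapositive_currified; [assumption|].
    apply Rinv_neq_0_compat, Rmult_integral_contrapositive_currified; assumption. }
  replace (4 ^ k * INR (Factorial.fact k) / INR (Factorial.fact (2 * k)) / sqrt PI)
    with (/ p * / sqrt PI) by (unfold p; field; repeat split; assumption).
  rewrite RtoC_mult, H, (RtoC_inv p) by assumption. field. now apply RtoC_neq0.
Qed.

(** The even part is the [I_(-nu)] part: up to sign, the recursion factor at [2k] is the argument
    that [rgamma_S] splits off when the order drops by one. The constant [sqrt PI] stems from
    [l = 0], where values of [rgamma] at half-integers occur. *)
Lemma Kseries_even (l k : nat) : Kseries l (2 * k) =
  (RtoC ((-1) ^ l * sqrt PI) * Icoef (RtoC (- (INR l + / 2))) k)%C.
Proof.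
  induction l.
  - unfold Icoef. replace (RtoC (INR k) + RtoC (- (INR 0 + / 2)) + 1)%C
      with (RtoC (/ 2) + RtoC (INR k))%C
      by (rewrite <- !RtoC_plus; f_equal; simpl; field).
    rewrite rgamma_half_nat, <- RtoC_div, <- RtoC_mult by apply INR_fact_neq_0.
    unfold Kseries, expc. f_equal. rewrite pow_mult. replace ((-2) ^ 2) with 4 by ring.
    simpl pow. pose proof sqrt_PI_neq0. pose proof (INR_fact_neq_0 k). pose proof (INR_fact_neq_0 (2 * k)).
    field. repeat split; assumption.
  - rewrite Kseries_S. rewrite IHl. unfold Icoef.
    replace (RtoC (INR k) + RtoC (- (INR l + / 2)) + 1)%C
      with (RtoC (INR k) + RtoC (- (INR (S l) + / 2)) + 1 + 1)%C
      by (rewrite <- !RtoC_plus; f_equal; rewrite S_INR; ring).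
    rewrite (rgamma_S (RtoC (INR k) + RtoC (- (INR (S l) + / 2)) + 1)).
    set (r := rgamma _).
    replace (RtoC (INR k) + RtoC (- (INR (S l) + / 2)) + 1)%C
      with (RtoC (- ((2 * INR l + 1 - INR (2 * k)) / 2)))
      by (rewrite <- !RtoC_plus; f_equal; rewrite S_INR, mult_INR, INR_2; field).
    simpl pow. rewrite !RtoC_mult, !RtoC_opp. unfold Cdiv. ring.
Qed.

(** The odd part is [y^(2l+1)] times the [I_nu] series. At the index [2 (k + 1 + l) + 1] the
    recursion factor is [-(k + 1)], which lowers [(k + 1)!] to [k!]. *)
Lemma Kseries_odd (l k : nat) : Kseries l (2 * (k + l) + 1) =
  (RtoC (- (-1) ^ l * sqrt PI) * Icoef (RtoC (INR l + / 2)) k)%C.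
Proof.
  revert k. induction l; intros k.
  - unfold Icoef. replace (RtoC (INR k) + RtoC (INR 0 + / 2) + 1)%C
      with (RtoC (/ 2) + RtoC (INR (S k)))%C
      by (rewrite <- !RtoC_plus; f_equal; rewrite S_INR; simpl; field).
    rewrite rgamma_half_nat, <- RtoC_div, <- RtoC_mult by apply INR_fact_neq_0.
    unfold Kseries, expc. f_equal. rewrite Nat.add_0_r.
    replace (2 * S k)%nat with (S (2 * k + 1)) by lia.
    rewrite pow_add, pow_mult. replace ((-2) ^ 2) with 4 by ring.
    rewrite (fact_simpl (2 * k + 1)), (fact_simpl k), !mult_INR, !S_INR, plus_INR, mult_INR, INR_2, INR_1.
    simpl pow. pose proof sqrt_PI_neq0. pose proof (INR_fact_neq_0 k).
    pose proof (INR_fact_neq_0 (2 * k + 1)). pose proof (pos_INR k).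
    field. repeat split; try assumption; lra.
  - rewrite Kseries_S. replace (k + S l)%nat with (S k + l)%nat by lia. rewrite IHl. unfold Icoef.
    replace (RtoC (INR (S k)) + RtoC (INR l + / 2) + 1)%C
      with (RtoC (INR k) + RtoC (INR (S l) + / 2) + 1)%C
      by (rewrite <- !RtoC_plus; f_equal; rewrite !S_INR; ring).
    set (r := rgamma _).
    replace ((2 * INR l + 1 - INR (2 * (S k + l) + 1)) / 2) with (- (INR k + 1))
      by (rewrite plus_INR, mult_INR, plus_INR, INR_2, INR_1, S_INR; field).
    rewrite fact_S_C. simpl pow. rewrite !RtoC_mult, !RtoC_opp, !RtoC_mult.
    pose proof (fact_neq0_C k). pose proof (INR_S_neq0_C k). field. split; assumption.
Qed.

(** The recursion step from [m] to [m + 1] multiplies the coefficient of index [2m + 1] by zero. *)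
Lemma Kseries_odd_0 (l m : nat) : (m < l)%nat -> Kseries l (2 * m + 1) = RtoC 0.
Proof.
  induction l; intros Hm; [lia|]. rewrite Kseries_S.
  destruct (Nat.eq_dec m l) as [->|Hne].
  - replace ((2 * INR l + 1 - INR (2 * l + 1)) / 2) with 0
      by (rewrite plus_INR, mult_INR, INR_2, INR_1; field). ring.
  - rewrite IHl by lia. ring.
Qed.

(** One function is summed in two ways: by parity of the index it is the difference of two Bessel
    series, as a Cauchy product it is an exponential times a polynomial. *)
Lemma Bessel_half_difference (l : nat) (y : R) :
  (RtoC ((-1) ^ l * sqrt PI) * (CPS (Icoef (RtoC (- (INR l + / 2)))) (y ^ 2)
     - RtoC (y ^ (2 * l + 1)) * CPS (Icoef (RtoC (INR l + / 2))) (y ^ 2)))%C =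
  (RtoC (exp (-2 * y)) * sum_n (fun k => Kpoly l k * RtoC (y ^ k))%C l)%C.
Proof.
  transitivity (CPS (Kseries l) y).
  - symmetry. apply is_CPS_unique.
    replace (RtoC ((-1) ^ l * sqrt PI) * (CPS (Icoef (RtoC (- (INR l + / 2)))) (y ^ 2)
       - RtoC (y ^ (2 * l + 1)) * CPS (Icoef (RtoC (INR l + / 2))) (y ^ 2)))%C
     with (RtoC ((-1) ^ l * sqrt PI) * CPS (Icoef (RtoC (- (INR l + / 2)))) (y ^ 2) +
       RtoC y * (RtoC ((y ^ 2) ^ l) *
         (RtoC (- (-1) ^ l * sqrt PI) * CPS (Icoef (RtoC (INR l + / 2))) (y ^ 2))))%C.
    + apply is_CPS_odd_even.
      * eapply is_CPS_ext; [intros k; symmetry; apply Kseries_even|].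
        apply is_CPS_scal, CPS_correct, entire_Icoef.
      * apply is_CPS_incr_n; [exact (Kseries_odd_0 l)|].
        eapply is_CPS_ext; [intros k; symmetry; apply Kseries_odd|].
        apply is_CPS_scal, CPS_correct, entire_Icoef.
    + set (U := CPS _ _). set (V := CPS _ _).
      rewrite pow_add, pow_mult, pow_1, !RtoC_mult, RtoC_opp. ring.
  - apply is_CPS_unique.
    eapply is_CPS_ext; [intros n; symmetry; apply Kseries_conv|].
    apply is_CPS_conv.
    + apply entire_expc.
    + intros z. eexists. apply is_CPS_finite, (Kpoly_0 l).
    + apply is_CPS_expc.
    + apply is_CPS_finite, (Kpoly_0 l).
Qed.

Lemma sin_half_odd (l : nat) : sin ((INR l + / 2) * PI) = (-1) ^ l.
Proof.
  induction l.
  - simpl. rewrite <- sin_PI2. f_equal. field.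
  - rewrite S_INR. replace ((INR l + 1 + / 2) * PI) with ((INR l + / 2) * PI + PI) by ring.
    rewrite neg_sin, IHl. simpl. ring.
Qed.

Lemma pow_m1_neq0 (l : nat) : (-1) ^ l <> 0.
Proof. apply pow_nonzero. lra. Qed.

Lemma pow_m1_sqr (l : nat) : (-1) ^ l * (-1) ^ l = 1.
Proof. rewrite <- Rpow_mult_distr. replace (-1 * -1) with 1 by ring. apply pow1. Qed.

(** In the definition of [K] the sine equals [(-1)^l] and cancels the sign of the difference; of
    [PI = sqrt PI * sqrt PI] one factor is used up by that difference. *)
Lemma Ktilde_half (l : nat) (y : R) : 0 < y ->
  (RtoC (y ^ (2 * l + 1)) * Ktilde (INR l + / 2) (2 * y))%C =
  (RtoC (sqrt PI / 2 * exp (-2 * y)) * sum_n (fun k => Kpoly l k * RtoC (y ^ k))%C l)%C.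
Proof.
  intros Hy. unfold Ktilde, BesselK, BesselI.
  rewrite !Itilde_CPS, sin_half_odd, !rcpow_RtoC.
  replace (2 * y / 2) with y by field.
  rewrite RtoC_mult, <- Cmult_assoc, <- Bessel_half_difference.
  set (U := CPS _ _). set (V := CPS _ _).
  set (p := Rpower y (INR l + / 2)).
  assert (Hp : p <> 0) by (apply Rgt_not_eq, exp_pos).
  assert (E1 : Rpower y (- (INR l + / 2)) = / p) by apply Rpower_Ropp.
  assert (E2 : y ^ (2 * l + 1) = p * p).
  { unfold p. rewrite <- Rpower_plus, <- Rpower_pow by assumption. f_equal.
    rewrite plus_INR, mult_INR, INR_2, INR_1. field. }
  rewrite E1, E2, !RtoC_mult, !RtoC_div, RtoC_inv by (assumption || lra).
  assert (EP : RtoC PI = (RtoC (sqrt PI) * RtoC (sqrt PI))%C).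
  { rewrite <- RtoC_mult, sqrt_sqrt; [reflexivity | apply Rlt_le, PI_RGT_0]. }
  assert (Es : (/ RtoC ((-1) ^ l))%C = RtoC ((-1) ^ l)).
  { rewrite <- RtoC_inv by apply pow_m1_neq0. f_equal.
    apply Rmult_eq_reg_l with ((-1) ^ l); [|apply pow_m1_neq0].
    rewrite pow_m1_sqr. apply Rinv_r, pow_m1_neq0. }
  unfold Cdiv at 1. rewrite Es, EP. apply RtoC_neq0 in Hp. field. exact Hp.
Qed.

(** * The series of [exp (- y / 2) * Itilde nu (y / 2)] *)

(** The series of [Itilde nu (y / 2)] in powers of [y] rather than [y^2], so that it can be
    convolved with an exponential series; [1/16] comes from [(y/4)^2]. *)
Definition Iseries (nu : C) (n : nat) : C :=
  if Nat.even n then (Icoef nu (Nat.div2 n) * RtoC ((/ 16) ^ Nat.div2 n))%C else RtoC 0.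

Lemma Iseries_even (nu : C) (k : nat) :
  Iseries nu (2 * k) = (Icoef nu k * RtoC ((/ 16) ^ k))%C.
Proof. unfold Iseries. now rewrite Nat.even_mul, Nat.div2_double. Qed.

Lemma Iseries_odd (nu : C) (k : nat) : Iseries nu (2 * k + 1) = RtoC 0.
Proof. unfold Iseries. now rewrite Nat.even_add, Nat.even_mul. Qed.

Lemma is_CPS_Iseries (nu : C) (y : R) : is_CPS (Iseries nu) y (Itilde nu (RtoC (y / 2))).
Proof.
  replace (y / 2) with (2 * (y / 4)) by field. rewrite Itilde_CPS.
  replace (CPS (Icoef nu) ((y / 4) ^ 2)) with
    (CPS (Icoef nu) (/ 16 * y ^ 2) + RtoC y * RtoC 0)%C
    by (replace (/ 16 * y ^ 2) with ((y / 4) ^ 2) by field; ring).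
  apply is_CPS_odd_even.
  - eapply is_CPS_ext; [intros k; symmetry; apply Iseries_even|].
    apply is_CPS_dilate, CPS_correct, entire_Icoef.
  - eapply is_CPS_ext; [intros k; symmetry; apply Iseries_odd|]. apply is_CPS_0.
Qed.

(* Bessel's equation [z f'' + (2 nu + 1) f' = z f] in terms of [theta = z d/dz]. *)
Lemma Iseries_bessel (nu : C) (n : nat) :
  (theta (theta (Iseries nu)) n + 2 * nu * theta (Iseries nu) n)%C =
  (RtoC (/ 4) * shift (shift (Iseries nu)) n)%C.
Proof.
  unfold theta. destruct (Nat.Even_or_Odd n) as [[k ->]|[k ->]].
  - destruct k as [|k]; [simpl; ring|].
    replace (shift (shift (Iseries nu)) (2 * S k)) with (Iseries nu (2 * k)).
    2:{ replace (2 * S k)%nat with (S (S (2 * k))) by lia. reflexivity. }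
    rewrite !Iseries_even, mult_INR, INR_2, S_INR. unfold Icoef.
    rewrite (rgamma_S (RtoC (INR k) + nu + 1)), fact_S_C, S_INR.
    replace (RtoC (INR k + 1) + nu + 1)%C with (RtoC (INR k) + nu + 1 + 1)%C
      by (rewrite RtoC_plus; ring).
    set (r := rgamma _). simpl pow. rewrite !RtoC_mult.
    replace (/ 16) with (/ 4 * / 4) by field. rewrite RtoC_mult, RtoC_inv by lra.
    pose proof (fact_neq0_C k). pose proof (INR_S_neq0_C k) as Hk.
    rewrite RtoC_plus in *. field. split; assumption.
  - rewrite Iseries_odd.
    replace (shift (shift (Iseries nu)) (2 * k + 1)) with (RtoC 0); [ring|].
    destruct k as [|k]; [reflexivity|].
    replace (2 * S k + 1)%nat with (S (S (2 * k + 1))) by lia. symmetry; apply Iseries_odd.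
Qed.

Definition EIseries (nu : C) : nat -> C := conv (expc (- / 2)) (Iseries nu).

Lemma entire_Iseries (nu : C) : entire (Iseries nu).
Proof. intros y. eexists. apply is_CPS_Iseries. Qed.

Lemma entire_EIseries (nu : C) : entire (EIseries nu).
Proof. apply entire_conv; [apply entire_expc | apply entire_Iseries]. Qed.

Lemma CPS_EIseries (nu : C) (y : R) :
  CPS (EIseries nu) y = (RtoC (exp (- / 2 * y)) * Itilde nu (RtoC (y / 2)))%C.
Proof.
  apply is_CPS_unique, is_CPS_conv; auto using entire_expc, entire_Iseries, is_CPS_expc, is_CPS_Iseries.
Qed.

Lemma theta_conv_expc (c : R) (b : nat -> C) (n : nat) :
  theta (conv (expc c) b) n =
  (RtoC c * shift (conv (expc c) b) n + conv (expc c) (theta b) n)%C.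
Proof.
  rewrite theta_conv. f_equal.
  rewrite (conv_ext _ b (fun k => RtoC c * shift (expc c) k)%C b)
    by (reflexivity || apply theta_expc).
  now rewrite conv_scal_l, conv_shift_l.
Qed.

(** Behind the factor [exp (- y/2)] the operator [theta] becomes [theta + y/2]. In [(theta + y/2)^2
    + 2 nu (theta + y/2) = y^2/4] the terms [y^2/4] cancel, so Bessel's recurrence with step two
    becomes a two-term recurrence with step one. *)
Lemma EIseries_S (nu : C) (n : nat) :
  (RtoC (INR n + 1) * (RtoC (INR n + 1) + 2 * nu) * EIseries nu (S n))%C =
  (- (RtoC (INR n) + nu + RtoC (/ 2)) * EIseries nu n)%C.
Proof.
  set (b := Iseries nu). set (e := expc (- / 2)).
  set (c := conv e b). set (p := conv e (theta b)). set (q := conv e (theta (theta b))).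
  change (EIseries nu) with c.
  pose proof (theta_conv_expc (- / 2) b) as Hc. pose proof (theta_conv_expc (- / 2) (theta b)) as Hp.
  fold e in Hc, Hp. fold c in Hc. fold p in Hc, Hp. fold q in Hp.
  assert (Hq : (q (S n) + 2 * nu * p (S n))%C = (RtoC (/ 4) * shift c n)%C).
  { change (shift c n) with (shift (shift c) (S n)).
    replace (shift (shift c) (S n)) with (conv e (shift (shift b)) (S n)).
    2:{ rewrite conv_shift_r. simpl shift. apply conv_shift_r. }
    replace (q (S n) + 2 * nu * p (S n))%C with (1 * q (S n) + 2 * nu * p (S n))%C by ring.
    unfold q, p. rewrite <- conv_lincomb_r.
    replace (RtoC (/ 4) * conv e (shift (shift b)) (S n))%C with
      (RtoC (/ 4) * conv e (shift (shift b)) (S n) + 0 * conv e (shift (shift b)) (S n))%C by ring.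
    rewrite <- conv_lincomb_r. apply conv_ext; [reflexivity|]. intros k.
    pose proof (Iseries_bessel nu k) as B. fold b in B.
    rewrite Cmult_1_l, B. ring. }
  pose proof (Hc n) as C0. pose proof (Hc (S n)) as C1. pose proof (Hp (S n)) as P1.
  unfold theta at 1 in C0. unfold theta at 1 in C1. unfold theta at 1 in P1. rewrite S_INR in C1, P1.
  change (shift c (S n)) with (c n) in C1. change (shift p (S n)) with (p n) in P1.
  assert (E0 : p n = (RtoC (INR n) * c n - RtoC (- / 2) * shift c n)%C) by (rewrite C0; ring).
  assert (E1 : p (S n) = (RtoC (INR n + 1) * c (S n) - RtoC (- / 2) * c n)%C) by (rewrite C1; ring).
  assert (E2 : q (S n) = (RtoC (INR n + 1) * p (S n) - RtoC (- / 2) * p n)%C) by (rewrite P1; ring).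
  rewrite E2, E1, E0 in Hq.
  replace (RtoC (- / 2)) with (- / RtoC 2)%C in Hq by (rewrite RtoC_opp, RtoC_inv by lra; reflexivity).
  replace (RtoC (/ 4)) with (/ RtoC 2 * / RtoC 2)%C in Hq
    by (rewrite <- !RtoC_inv, <- RtoC_mult by lra; f_equal; field).
  replace (RtoC (/ 2)) with (/ RtoC 2)%C by (rewrite RtoC_inv by lra; reflexivity).
  assert (R2 : RtoC 2 <> RtoC 0) by (apply RtoC_neq0; lra).
  apply Ceq_minus in Hq. apply Ceq_minus.
  etransitivity; [|exact Hq]. rewrite !RtoC_plus. field.
Qed.

(* Kummer's second formula [exp (-z) Itilde nu z = 1F1 (nu + 1/2; 2 nu + 1; -2 z) / Gamma (nu + 1)]. *)
Lemma EIseries_closed (mu : C) (n : nat) :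
  (forall k : nat, mu <> RtoC (- (INR k + 1))) ->
  EIseries (mu / 2) n =
  (RtoC ((-1) ^ n) * rgamma (mu / 2 + 1) * poch ((mu + 1) / 2) n
   / (RtoC (INR (Factorial.fact n)) * poch (mu + 1) n))%C.
Proof.
  intros Hmu.
  assert (Hne : forall k : nat, (mu + 1 + RtoC (INR k))%C <> RtoC 0).
  { intros k E. apply (Hmu k). rewrite RtoC_opp, RtoC_plus.
    replace mu with (mu + 1 + RtoC (INR k) - (RtoC (INR k) + 1))%C by ring. rewrite E. ring. }
  assert (Hp : forall k, poch (mu + 1) k <> RtoC 0).
  { intros k. induction k; [rewrite poch_0; apply C1_nz|]. rewrite poch_S. now apply Cmult_neq_0. }
  induction n.
  - unfold EIseries, conv. rewrite Csum_O. simpl Nat.sub.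
    replace (Iseries (mu / 2) 0) with (Icoef (mu / 2) 0)
      by (unfold Iseries; simpl; ring).
    unfold Icoef, expc. simpl. replace (0 + mu / 2 + 1)%C with (mu / 2 + 1)%C by ring.
    replace (1 / 1) with 1 by field. field.
  - pose proof (EIseries_S (mu / 2) n) as E. rewrite IHn in E.
    (* With [nu = mu / 2] the recurrence divides by [(n + 1) (mu + 1 + n)], the next factors of [n!]
       and of [poch (mu + 1)]. *)
    assert (Hd : (RtoC (INR n + 1) * (RtoC (INR n + 1) + 2 * (mu / 2)))%C <> RtoC 0).
    { apply Cmult_neq_0; [apply INR_S_neq0_C|].
      replace (RtoC (INR n + 1) + 2 * (mu / 2))%C with (mu + 1 + RtoC (INR n))%C
        by (rewrite RtoC_plus; field). apply Hne. }
    set (d := (RtoC (INR n + 1) * (RtoC (INR n + 1) + 2 * (mu / 2)))%C) in *.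
    replace (EIseries (mu / 2) (S n)) with (d * EIseries (mu / 2) (S n) / d)%C by (field; exact Hd).
    rewrite E, !poch_S, fact_S_C. simpl pow. unfold d. rewrite RtoC_mult.
    pose proof (Hne n) as H1. pose proof (Hp n) as H2. pose proof (fact_neq0_C n) as H3.
    pose proof (INR_S_neq0_C n) as H4. rewrite !RtoC_plus, RtoC_inv in * by lra.
    field. repeat split; assumption.
Qed.

(** * The polynomials *)

Lemma Csum_drop (u : nat -> C) (j p : nat) :
  (forall n, (n < p)%nat -> u n = RtoC 0) ->
  sum_n u (j + p) = sum_n (fun m => u (m + p)%nat) j :> C.
Proof.
  revert u. induction p; intros u Hu.
  - rewrite Nat.add_0_r. apply Csum_ext. intros k _. f_equal; lia.
  - rewrite Nat.add_succ_r, Csum_S_l, Hu, Cplus_0_l by lia.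
    rewrite (IHp (fun k => u (S k))) by (intros n Hn; apply Hu; lia).
    apply Csum_ext. intros k _. f_equal; lia.
Qed.

(** Degree [j + l] is reached only by [(k, m) = (l, j)] and degree 0 only by [(0, 0)], so these two
    coefficients involve no sum. *)
Lemma double_sum_polynomial (A : nat -> nat -> C) (j l : nat) :
  exists c : nat -> C,
    (forall n, (j + l < n)%nat -> c n = RtoC 0) /\
    (forall x : C, sum_n (fun k => sum_n (fun m => A k m * Cpow x (k + m))%C j) l =
       sum_n (fun n => c n * Cpow x n)%C (j + l) :> C) /\
    c (j + l)%nat = A l j /\ c O = A O O.
Proof.
  induction l as [|l (c & C0 & Cs & Ct & Cc)].
  - exists (fun n => if Nat.leb n j then A O n else RtoC 0). repeat split.
    + intros n Hn. now rewrite (proj2 (Nat.leb_gt n j)) by lia.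
    + intros x. rewrite Csum_O, Nat.add_0_r. apply Csum_ext. intros k Hk.
      now rewrite (proj2 (Nat.leb_le k j)).
    + rewrite Nat.add_0_r. now rewrite Nat.leb_refl.
  - set (u := fun n => if Nat.leb (S l) n then
       (if Nat.leb n (j + S l) then A (S l) (n - S l)%nat else RtoC 0) else RtoC 0).
    exists (fun n => c n + u n)%C. repeat split.
    + intros n Hn. rewrite C0 by lia. unfold u.
      rewrite (proj2 (Nat.leb_gt n (j + S l))) by lia. destruct (Nat.leb (S l) n); ring.
    + intros x. rewrite Csum_S, Cs.
      rewrite (Csum_ext (fun n => (c n + u n) * Cpow x n)%C
        (fun n => c n * Cpow x n + u n * Cpow x n)%C) by (intros; ring).
      rewrite Csum_plus. f_equal.
      * rewrite Nat.add_succ_r, Csum_S, C0, Cmult_0_l, Cplus_0_r by lia. reflexivity.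
      * rewrite Csum_drop.
        -- apply Csum_ext. intros m Hm. unfold u.
           rewrite (proj2 (Nat.leb_le (S l) (m + S l))), (proj2 (Nat.leb_le (m + S l) (j + S l))) by lia.
           now rewrite Nat.add_sub, (Nat.add_comm m).
        -- intros n Hn. unfold u. rewrite (proj2 (Nat.leb_gt (S l) n)) by lia. ring.
    + rewrite C0 by lia. unfold u.
      rewrite (proj2 (Nat.leb_le (S l) (j + S l))), Nat.leb_refl, Nat.add_sub by lia. ring.
    + rewrite Cc. unfold u. simpl. ring.
Qed.

Lemma rcpow_INR (a : R) (n : nat) : 0 < a -> rcpow a (RtoC (INR n)) = RtoC (a ^ n).
Proof. intros Ha. now rewrite rcpow_RtoC, Rpower_pow. Qed.

(** Writing [(x/2)^(2l+1)] as [(2 (1 - t) y)^(2l+1)] supplies [(1 - t)^(2l+1)], and [y^k] supplies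
    [(1 - t)^-k]; with the prefactor of [G] the exponent is [-((mu + 1)/2 - l + k)]. The constant is
    [2^(2l+1)] times the [sqrt PI / 2] of [Ktilde_half]. *)
Lemma G_pullback (mu : C) (l : nat) (t x : R) : 0 < x -> t < 1 ->
  G mu l t x = sum_n (fun k =>
    RtoC (2 ^ (2 * l) * sqrt PI) * Kpoly l k * RtoC ((x / 4) ^ k) *
    pullback ((mu + 1) / 2 - RtoC (INR l) + RtoC (INR k)) (EIseries (mu / 2)) x t)%C l.
Proof.
  intros Hx Ht. unfold G.
  set (s := x * t / (1 - t)). set (y := x / (4 * (1 - t))).
  assert (Hy : 0 < y) by (apply Rdiv_lt_0_compat; lra).
  replace (x / (2 * (1 - t))) with (2 * y) by (unfold y; field; lra).
  replace (t * x / (2 * (1 - t))) with (s / 2) by (unfold s; field; lra).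
  replace ((x / 2) ^ (2 * l + 1)) with ((2 * (1 - t)) ^ (2 * l + 1) * y ^ (2 * l + 1)).
  2:{ rewrite <- Rpow_mult_distr. f_equal. unfold y. field. lra. }
  set (w := rcpow _ _).
  transitivity (w * RtoC ((2 * (1 - t)) ^ (2 * l + 1) * exp (x / 2)) * Itilde (mu / 2) (RtoC (s / 2))
    * (RtoC (y ^ (2 * l + 1)) * Ktilde (INR l + / 2) (2 * y)))%C.
  { rewrite !RtoC_mult. ring. }
  rewrite Ktilde_half by exact Hy. rewrite <- !Csum_mult_l. apply Csum_ext. intros k _.
  unfold pullback. fold s. rewrite CPS_EIseries.
  replace (- ((mu + 1) / 2 - RtoC (INR l) + RtoC (INR k)))%C with
    (- (RtoC (INR l) + (mu + 3) / 2) + RtoC (INR (2 * l + 1)) + - RtoC (INR k))%C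
    by (rewrite plus_INR, mult_INR, INR_2, INR_1, RtoC_plus, RtoC_mult; field).
  rewrite !rcpow_plus, (rcpow_opp _ (RtoC (INR k))), !rcpow_INR by lra.
  fold w.
  replace (exp (- / 2 * s)) with (exp (x / 2) * exp (-2 * y)).
  2:{ rewrite <- exp_plus. f_equal. unfold y, s. field. lra. }
  replace (y ^ k) with ((x / 4) ^ k * / (1 - t) ^ k).
  2:{ rewrite <- pow_inv, <- Rpow_mult_distr by lra. f_equal. unfold y. field. lra. }
  rewrite Rpow_mult_distr, (pow_add 2), pow_1.
  rewrite !RtoC_mult, (RtoC_div (sqrt PI) 2), (RtoC_inv ((1 - t) ^ k)) by (try apply pow_nonzero; lra).
  field. apply RtoC_neq0, pow_nonzero. lra.
Qed.

Lemma Cderive_n_G (mu : C) (l j : nat) (x : R) : 0 < x ->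
  Cderive_n (fun t => G mu l t x) j 0 = sum_n (fun k =>
    RtoC (2 ^ (2 * l) * sqrt PI) * Kpoly l k * RtoC ((x / 4) ^ k) *
    pullback_deriv j ((mu + 1) / 2 - RtoC (INR l) + RtoC (INR k)) (EIseries (mu / 2)) x)%C l.
Proof.
  intros Hx. apply has_derivative0_Cderive_n.
  apply has_derivative0_ext_loc with (fun t => sum_n (fun k =>
    RtoC (2 ^ (2 * l) * sqrt PI) * Kpoly l k * RtoC ((x / 4) ^ k) *
    pullback ((mu + 1) / 2 - RtoC (INR l) + RtoC (INR k)) (EIseries (mu / 2)) x t)%C l).
  - exists (mkposreal 1 Rlt_0_1). intros t Ht. symmetry. apply G_pullback; [exact Hx|].
    unfold ball in Ht; simpl in Ht; unfold AbsRing_ball, abs, minus, plus, opp in Ht; simpl in Ht.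
    apply Rabs_def2 in Ht. lra.
  - apply (has_derivative0_sum j l (fun k => pullback ((mu + 1) / 2 - RtoC (INR l) + RtoC (INR k))%C
      (EIseries (mu / 2)) x)).
    intros k. apply has_derivative0_pullback, entire_EIseries.
Qed.

Theorem theorem2p1 (mu : C) (l : nat)
  (hmu : forall n : nat, mu <> RtoC (- (INR n + 1))%R) :
  forall j : nat,
    exists c : nat -> C,
      (forall x : R, (0 < x)%R ->
         M mu l j x = sum_n (fun k => Cmult (c k) (Cpow (RtoC x) k)) (j + l)%nat) /\
      c (j + l)%nat = Cdiv (RtoC ((-1) ^ j)%R) (RtoC (INR (Factorial.fact j))) /\
      c O = Cdiv
              (Cmult (Cmult (Cmult (rcpow 2 (Cminus (RtoC (2 * INR l)%R) mu))
                                   (CGamma (RtoC (INR l + / 2)%R)))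
                            (CGamma (Cplus (RtoC (INR j)) (Cplus mu (RtoC 1)))))
                     (poch (Cminus (Cdiv (Cplus mu (RtoC 1)) (RtoC 2)) (RtoC (INR l))) j))
              (Cmult (Cmult (RtoC (INR (Factorial.fact j)))
                            (CGamma (Cdiv (Cplus mu (RtoC 2)) (RtoC 2))))
                     (CGamma (Cplus (RtoC (INR j)) (Cdiv (Cplus mu (RtoC 1)) (RtoC 2))))).
Proof.
  intros j.
  set (g1 := CGamma (RtoC (INR j) + (mu + RtoC 1))%C).
  set (g2 := CGamma (RtoC (INR j) + (mu + RtoC 1) / RtoC 2)%C).
  set (P := (g1 / (RtoC (INR (Factorial.fact j)) * rcpow 2 mu * g2))%C).
  set (b := fun k : nat => ((mu + RtoC 1) / RtoC 2 - RtoC (INR l) + RtoC (INR k))%C).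
  set (a := EIseries (mu / 2)).
  (* The contribution to [x^(k + m)] of the term [k] of the [K] polynomial and the term [m] of the
     series of [F]; the factor [(1/4)^k] is that of [(x/4)^k]. *)
  set (A := fun k m : nat => (P * (RtoC (2 ^ (2 * l) * sqrt PI) * Kpoly l k * RtoC ((/ 4) ^ k) *
    (RtoC (INR (Factorial.fact j)) * (a m * poch (b k + RtoC (INR m)) (j - m))
      / RtoC (INR (Factorial.fact (j - m))))))%C).
  (* A zero of [rgamma] at [mu + 1], [(mu + 1)/2] or [mu/2 + 1] would force [mu] to be [-(k + 1)],
     [-(2k + 1)] or [-(2k + 2)]. *)
  assert (Hmu2 : forall k : nat, (mu + 1)%C <> RtoC (- INR k)).
  { intros k E. apply (hmu k). replace mu with (mu + 1 - 1)%C by ring.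
    rewrite E, !RtoC_opp, RtoC_plus. ring. }
  assert (Hmu3 : forall k : nat, ((mu + 1) / 2)%C <> RtoC (- INR k)).
  { intros k E. apply (hmu (2 * k)%nat). replace mu with (2 * ((mu + 1) / 2) - 1)%C by field.
    rewrite E, !RtoC_opp, RtoC_plus, mult_INR, INR_2, RtoC_mult. ring. }
  assert (Hmu4 : forall k : nat, (mu / 2 + 1)%C <> RtoC (- INR k)).
  { intros k E. apply (hmu (2 * k + 1)%nat). replace mu with (2 * (mu / 2 + 1) - 2)%C by field.
    rewrite E, !RtoC_opp, RtoC_plus, plus_INR, mult_INR, INR_2, INR_1, RtoC_plus, RtoC_mult. ring. }
  assert (R1 : rgamma (mu + 1) <> RtoC 0) by now apply rgamma_neq0.
  assert (R2 : rgamma ((mu + 1) / 2) <> RtoC 0) by now apply rgamma_neq0.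
  assert (R3 : rgamma (mu / 2 + 1) <> RtoC 0) by now apply rgamma_neq0.
  pose proof (rgamma_poch (mu + 1) j) as Q1. pose proof (rgamma_poch ((mu + 1) / 2) j) as Q2.
  pose proof (poch_neq0 _ j Hmu2) as N1. pose proof (poch_neq0 _ j Hmu3) as N2.
  assert (R4 : rgamma (mu + 1 + RtoC (INR j)) <> RtoC 0)
    by (intros E; apply R1; rewrite Q1, E; ring).
  assert (R5 : rgamma ((mu + 1) / 2 + RtoC (INR j)) <> RtoC 0)
    by (intros E; apply R2; rewrite Q2, E; ring).
  assert (Ng1 : g1 = (/ rgamma (mu + 1 + RtoC (INR j)))%C)
    by (unfold g1, CGamma; do 2 f_equal; ring).
  assert (Ng2 : g2 = (/ rgamma ((mu + 1) / 2 + RtoC (INR j)))%C)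
    by (unfold g2, CGamma; do 2 f_equal; ring).
  assert (N3 : rcpow 2 mu <> RtoC 0) by apply rcpow_neq0.
  pose proof (fact_neq0_C j) as N4.
  assert (N5 : RtoC (sqrt PI) <> RtoC 0) by apply RtoC_neq0, sqrt_PI_neq0.
  assert (N6 : RtoC 2 <> RtoC 0) by (apply RtoC_neq0; lra).
  destruct (double_sum_polynomial A j l) as (c & _ & Cs & Ct & Cc).
  exists c. repeat split.
  - intros x Hx. rewrite <- Cs. unfold M. rewrite Cderive_n_G by exact Hx.
    fold g1 g2 P a. rewrite <- Csum_mult_l. apply Csum_ext. intros k _.
    unfold pullback_deriv. rewrite <- !Csum_mult_l. apply Csum_ext. intros m _.
    unfold A. fold (b k). rewrite Cpow_add_r, <- !RtoC_pow.
    replace (x / 4) with (/ 4 * x) by field. rewrite Rpow_mult_distr, !RtoC_mult.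
    unfold Cdiv. ring.
  - rewrite Ct. unfold A. rewrite Kpoly_top, Nat.sub_diag, poch_0. unfold a.
    rewrite EIseries_closed by exact hmu. unfold P. rewrite Ng1, Ng2.
    (* At this point the formula relates all three Gamma values in the top coefficient: those at
       [(mu + 1)/2] and [mu + 1] from [P], and that at [mu/2 + 1] from [EIseries_closed]. *)
    pose proof (rgamma_duplication ((mu + 1) / 2)) as D.
    replace ((mu + 1) / 2 + RtoC (/ 2))%C with (mu / 2 + 1)%C in D
      by (rewrite RtoC_inv by lra; field).
    replace (2 * ((mu + 1) / 2))%C with (mu + 1)%C in D by field.
    rewrite rcpow_plus, rcpow_1, rgamma_half in D by lra.
    rewrite RtoC_inv in D by apply sqrt_PI_neq0.
    assert (E : rgamma (mu / 2 + 1) =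
      (rgamma (mu + 1) * rcpow 2 mu / (RtoC (sqrt PI) * rgamma ((mu + 1) / 2)))%C).
    { replace (rgamma (mu / 2 + 1)) with
        (rgamma ((mu + 1) / 2) * rgamma (mu / 2 + 1) / rgamma ((mu + 1) / 2))%C by (field; exact R2).
      rewrite D. field. split; assumption. }
    (* [Q1] and [Q2] move the Gamma values by [j] and cancel the Pochhammer symbols of the closed
       form; [2^(2l)] cancels against [(1/4)^l]. *)
    rewrite E, Q1, Q2. rewrite pow_mult. replace (2 ^ 2) with 4 by ring.
    rewrite pow_inv, RtoC_mult, RtoC_inv by (apply pow_nonzero; lra).
    assert (N7 : RtoC (4 ^ l) <> RtoC 0) by (apply RtoC_neq0, pow_nonzero; lra).
    simpl (Factorial.fact 0). simpl (INR 1).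
    field. repeat split; assumption.
  - rewrite Cc. unfold A. rewrite Kpoly_const, Nat.sub_0_r. unfold a.
    rewrite EIseries_closed by exact hmu. unfold b, P. simpl (INR 0).
    rewrite !Cplus_0_r, Ng1, Ng2. unfold CGamma.
    replace ((mu + RtoC 2) / RtoC 2)%C with (mu / 2 + 1)%C by field.
    pose proof (rgamma_poch (RtoC (/ 2)) l) as Q3. rewrite rgamma_half, <- RtoC_plus in Q3.
    rewrite (Rplus_comm (/ 2)) in Q3. rewrite RtoC_inv in Q3 by apply sqrt_PI_neq0.
    (* Here [sqrt PI] from [K] and the constant term [(1/2)_l] of its polynomial combine into
       [Gamma (l + 1/2)]. *)
    assert (E3 : (RtoC (sqrt PI) * poch (RtoC (/ 2)) l)%C = (/ rgamma (RtoC (INR l + / 2)))%C).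
    { assert (R6 : rgamma (RtoC (INR l + / 2)) <> RtoC 0).
      { apply rgamma_neq0. intros k F. apply RtoC_inj in F.
        pose proof (pos_INR k). pose proof (pos_INR l). lra. }
      replace (RtoC (sqrt PI) * poch (RtoC (/ 2)) l)%C with
        (RtoC (sqrt PI) * (poch (RtoC (/ 2)) l * rgamma (RtoC (INR l + / 2)))
          / rgamma (RtoC (INR l + / 2)))%C by (field; exact R6).
      rewrite <- Q3. field. split; assumption. }
    rewrite <- E3. unfold Cminus at 2. rewrite rcpow_plus, rcpow_opp, rcpow_RtoC.
    replace (2 * INR l) with (INR (2 * l)) by (rewrite mult_INR, INR_2; ring).
    rewrite Rpower_pow by lra. simpl (Factorial.fact 0). simpl (INR 1). simpl pow.
    rewrite !poch_0, !RtoC_mult. field. repeat split; assumption.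
Qed.
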